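(* Let $p$ be a prime, let $\mathbb{F}$ be an abelian extension of $\mathbb{Q}$ (inside $\mathbb{C}$), and let $a:=\nu_p(c(\mathbb{F}))$. Then for every integer $b\geq \nu_p([\mathbb{F}_{p^a}:\mathbb{F}])$ there exist a finite group $G$ and $\chi\in\operatorname{Irr}(G)$ such that $\mathbb{Q}(\chi)=\mathbb{F}$ and $\nu_p(\chi(1))=b$.
   Context: $\nu_p(n)$ denotes the $p$-adic valuation of a positive integer $n$ (the largest $a$ with $p^a\mid n$). For $n\ge1$, $\mathbb{Q}_n:=\mathbb{Q}(e^{2\pi i/n})$ is the $n$-th cyclotomic field (so $\mathbb{Q}_1=\mathbb{Q}$). For an abelian extension $\mathbb{F}/\mathbb{Q}$, the conductor $c(\mathbb{F})$ is the smallest integer $n\ge1$ with $\mathbb{F}\subseteq\mathbb{Q}_n$. For a field $\mathbb{F}\subseteq\mathbb{C}$ and $m\ge1$, $\mathbb{F}_m:=\mathbb{F}(e^{2\pi i/m})$. For an irreducible complex character $\chi$ of a finite group, $\mathbb{Q}(\chi)$ is the field generated over $\mathbb{Q}$ by all values of $\chi$ (the field of values), and $\operatorname{Irr}(G)$ is the set of complex irreducible characters of $G$. *)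

(* Defs.v *)
From HB Require Import structures.
From mathcomp Require Import all_boot all_order all_algebra all_fingroup all_solvable all_field all_character.
Set Implicit Arguments. Unset Strict Implicit. Unset Printing Implicit Defensive.
Import Order.TTheory GRing.Theory Num.Theory.
Local Open Scope ring_scope.

Definition cset := algC -> Prop.

Definition subc (A B : cset) : Prop := forall x, A x -> B x.

Definition is_subfield (K : cset) : Prop :=
  [/\ K 0, K 1,
      (forall x y, K x -> K y -> K (x + y)),
      (forall x, K x -> K (- x)) &
      (forall x y, K x -> K y -> K (x * y))] /\
  (forall x, K x -> x != 0 -> K x^-1).

Definition gen_field (S : cset) : cset :=
  fun x => forall K, is_subfield K -> subc S K -> K x.

Definition ratC : cset := fun x => exists q : rat, x = ratr q.

Definition in_span (K : cset) (s : seq algC) (x : algC) : Prop :=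
  exists c : 'I_(size s) -> algC,
    (forall i, K (c i)) /\ x = \sum_(i < size s) c i * s`_i.

Definition lin_free (K : cset) (s : seq algC) : Prop :=
  forall c : 'I_(size s) -> algC, (forall i, K (c i)) ->
    \sum_(i < size s) c i * s`_i = 0 -> forall i, c i = 0.

Definition is_degree (K L : cset) (d : nat) : Prop :=
  exists s : seq algC,
    [/\ size s = d, (forall i, (i < size s)%N -> L s`_i),
        lin_free K s & (forall x, L x -> in_span K s x)].

(* F is a (finite) abelian extension of Q inside algC: a subfield of finite
   dimension over Q, stable under every automorphism of algC (normal), and on
   which any two automorphisms of algC commute (abelian Galois group, since
   every automorphism of F extends to algC). *)
Definition abelian_ext (F : cset) : Prop :=
  [/\ is_subfield F,
      (exists s : seq algC, forall x, F x -> in_span ratC s x),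
      (forall sigma : {rmorphism algC -> algC}, forall x, F x -> F (sigma x)) &
      (forall sigma tau : {rmorphism algC -> algC}, forall x, F x ->
          sigma (tau x) = tau (sigma x))].

Definition cyc_ext (F : cset) (m : nat) : cset :=
  gen_field (fun x => F x \/ m.-primitive_root x).

Definition Qcyc (n : nat) : cset := cyc_ext ratC n.

Definition is_conductor (F : cset) (c : nat) : Prop :=
  [/\ (0 < c)%N, subc F (Qcyc c) &
      (forall n, (0 < n)%N -> subc F (Qcyc n) -> (c <= n)%N)].

Definition field_of_values (gT : finGroupType) (G : {group gT}) (chi : 'CF(G)) : cset :=
  gen_field (fun x => exists g : gT, x = chi g).

(* Main.v *)
(* Write c = p^a m0 with p prime to m0, and replace p^a by N = p^e with e >= max(a, 1), so
   that F lies in Q_(N m), where m = q - 1 for a power q of p with m0 | q - 1.  Let A be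
   the image of Gal(Q_(N m) / F) in (Z/N)^*, and let w_0, ..., w_n represent the elements
   of Gal(Q_(N m) / F) that act trivially on the N-th roots of unity.  Fix a faithful
   linear character lam of F_q^*.  For k in A, lifted to an automorphism u_k fixing F, the
   characters u_k w_i lam (0 <= i <= n) of the diagonal torus of GL_(n+1)(q) are pairwise
   distinct, hence give a principal series character of GL_(n+1)(q), irreducible, and of
   degree prime to p because a Borel subgroup contains a Sylow p-subgroup.  The group
   G = (Z/N x GL_(n+1)(q)^A) : A, where A acts on Z/N by multiplication and permutes the
   factors, has the irreducible character chi induced from the Borel subgroup
   Z/N x B^A by the product of these characters with a faithful character of Z/N.  By
   Mackey's formula and the Bruhat decomposition, an automorphism of the complex numbers
   fixes chi exactly when it fixes F, so that Q(chi) = F, and the p-part of chi(1) is that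
   of |A|.  When e increases by 1, |A| is multiplied by p; it is [F_(p^a) : F] for
   e = a >= 1, and prime to p for e = 1. *)
Require Import Defs.
From HB Require Import structures.
From mathcomp Require Import all_boot all_order all_algebra all_fingroup all_solvable all_field all_character.
From mathcomp Require Import boolp ring.
Import Order.TTheory GRing.Theory Num.Theory.
Local Open Scope ring_scope.
Set Implicit Arguments. Unset Strict Implicit. Unset Printing Implicit Defensive.

Local Notation aut := {rmorphism algC -> algC}.

(** * Subfields of cyclotomic fields *)

Section Subfields.
Implicit Types (K F S : cset) (u v : aut).

Section Closure.
Variables (K : cset) (Kf : is_subfield K).

Lemma subfield0 : K 0. Proof. by case: Kf => -[]. Qed.
Lemma subfield1 : K 1. Proof. by case: Kf => -[]. Qed.
Lemma subfieldD x y : K x -> K y -> K (x + y). Proof. by case: Kf => -[? ? + *]; apply. Qed.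
Lemma subfieldN x : K x -> K (- x). Proof. by case: Kf => -[? ? ? + *]; apply. Qed.
Lemma subfieldM x y : K x -> K y -> K (x * y). Proof. by case: Kf => -[? ? ? ? + *]; apply. Qed.
Lemma subfieldV x : K x -> K x^-1.
Proof.
move=> Kx; case: (eqVneq x 0) => [->|nz]; first by rewrite invr0; apply: subfield0.
by case: Kf => _; apply.
Qed.
Lemma subfield_sum (I : Type) (r : seq I) (P : pred I) (f : I -> algC) :
  (forall i, P i -> K (f i)) -> K (\sum_(i <- r | P i) f i).
Proof. move=> Kfi; apply: (big_ind K) => //; [exact: subfield0|exact: subfieldD]. Qed.
Lemma subfield_prod (I : Type) (r : seq I) (P : pred I) (f : I -> algC) :
  (forall i, P i -> K (f i)) -> K (\prod_(i <- r | P i) f i).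
Proof. move=> Kfi; apply: (big_ind K) => //; [exact: subfield1|exact: subfieldM]. Qed.
Lemma subfieldX x n : K x -> K (x ^+ n).
Proof. by move=> Kx; elim: n => [|n IHn]; rewrite ?exprS; [apply: subfield1|apply: subfieldM]. Qed.
Lemma subfield_nat n : K n%:R.
Proof. by elim: n => [|n IHn]; [apply: subfield0|rewrite mulrSr; apply: subfieldD => //; apply: subfield1]. Qed.
Lemma subfield_rat : subc ratC K.
Proof.
move=> _ [q ->]; rewrite /ratr; apply: subfieldM; last apply: subfieldV.
  case: (numq q) => n; first exact: subfield_nat.
  by rewrite NegzE rmorphN; apply/subfieldN/subfield_nat.
case: (denq q) => n; first exact: subfield_nat.
by rewrite NegzE rmorphN; apply/subfieldN/subfield_nat.
Qed.
End Closure.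

Lemma gen_subfield S : is_subfield (gen_field S).
Proof.
split; first split.
- by move=> K Kf _; apply: subfield0.
- by move=> K Kf _; apply: subfield1.
- by move=> x y Sx Sy K Kf SK; apply: subfieldD => //; [apply: Sx|apply: Sy].
- by move=> x Sx K Kf SK; apply: subfieldN => //; apply: Sx.
- by move=> x y Sx Sy K Kf SK; apply: subfieldM => //; [apply: Sx|apply: Sy].
by move=> x Sx _ K Kf SK; apply: subfieldV => //; apply: Sx.
Qed.

Lemma mem_gen S : subc S (gen_field S). Proof. by move=> x Sx K _; apply. Qed.

Lemma gen_min S K : is_subfield K -> subc S K -> subc (gen_field S) K.
Proof. by move=> Kf SK x; apply. Qed.

Lemma cyc_extS F m : subc F (cyc_ext F m).
Proof. by move=> x Fx; apply: mem_gen; left. Qed.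

Lemma cyc_ext_unity F m z : (0 < m)%N -> z ^+ m = 1 -> cyc_ext F m z.
Proof.
move=> m0 z1; have [w w1] := C_prim_root_exists m0.
have [i ->] := prim_rootP w1 z1.
by apply: (subfieldX (gen_subfield _)); apply: mem_gen; right.
Qed.

Lemma Qcyc_subfield n : is_subfield (Qcyc n). Proof. exact: gen_subfield. Qed.

Lemma Qcyc_dvd m n : (0 < n)%N -> (m %| n)%N -> subc (Qcyc m) (Qcyc n).
Proof.
move=> n0 /dvdnP[q Dn]; apply: gen_min; first exact: Qcyc_subfield.
move=> x [/(@cyc_extS _ n) //|/prim_expr_order x1].
by apply: cyc_ext_unity => //; rewrite Dn mulnC exprM x1 expr1n.
Qed.

Lemma eq_aut_subfield u v : is_subfield (fun x => u x = v x).
Proof.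
split; first split; rewrite ?rmorph0 ?rmorph1 // => x.
- by move=> y eqx eqy; rewrite !rmorphD /= eqx eqy.
- by move=> eqx; rewrite !rmorphN /= eqx.
- by move=> y eqx eqy; rewrite !rmorphM /= eqx eqy.
by move=> eqx _; rewrite !fmorphV /= eqx.
Qed.

Lemma preim_subfield u K : is_subfield K -> is_subfield (fun x => K (u x)).
Proof.
move=> Kf; split; first split; rewrite ?rmorph0 ?rmorph1 //.
- exact: subfield0.
- exact: subfield1.
- by move=> x y Kx Ky; rewrite rmorphD; apply: subfieldD.
- by move=> x Kx; rewrite rmorphN; apply: subfieldN.
- by move=> x y Kx Ky; rewrite rmorphM; apply: subfieldM.
by move=> x Kx _; rewrite fmorphV; apply: subfieldV.
Qed.

Lemma eq_aut_cyc F m z u v : m.-primitive_root z ->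
  (forall x, F x -> u x = v x) -> u z = v z ->
  forall x, cyc_ext F m x -> u x = v x.
Proof.
move=> zP uvF uvz; apply: (gen_min (eq_aut_subfield u v)) => x [/uvF //|].
by move/prim_expr_order/(prim_rootP zP) => [i ->]; rewrite !rmorphXn /= uvz.
Qed.

Lemma aut_rat u x : ratC x -> u x = x.
Proof. by case=> q ->; rewrite fmorph_rat. Qed.

Lemma eq_aut_Qcyc n z u v : n.-primitive_root z -> u z = v z ->
  forall x, Qcyc n x -> u x = v x.
Proof. by move=> zP uvz; apply: (eq_aut_cyc zP) => // x Qx; rewrite !aut_rat. Qed.

Lemma aut_cyc F m u x : (forall y, F y -> F (u y)) ->
  cyc_ext F m x -> cyc_ext F m (u x).
Proof.
move=> Fu; move: x; apply: (gen_min (preim_subfield u (gen_subfield _))) => x [Fx|x1].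
  by apply: cyc_extS; apply: Fu.
by apply: mem_gen; right; rewrite fmorph_primitive_root.
Qed.

Lemma aut_Qcyc m u x : Qcyc m x -> Qcyc m (u x).
Proof. by apply: aut_cyc => y Qy; rewrite aut_rat. Qed.

(** Write [x] as a rational polynomial in [z] inside the number field generated by [z], then reduce
    it modulo the minimal polynomial of [z], the cyclotomic polynomial of degree [totient n]. *)
Lemma Qcyc_poly n z x : n.-primitive_root z -> Qcyc n x ->
  exists2 h : {poly rat}, (size h <= totient n)%N & x = (map_poly ratr h).[z].
Proof.
move=> zP; have [Qn [QnC [[|zn []] // [Dz]]] genQn] := num_field_exists [:: z].
have imf : is_subfield (fun x => exists y, x = QnC y).
  split; first split.
  - by exists 0; rewrite rmorph0.
  - by exists 1; rewrite rmorph1.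
  - by move=> _ _ [y ->] [y' ->]; exists (y + y'); rewrite rmorphD.
  - by move=> _ [y ->]; exists (- y); rewrite rmorphN.
  - by move=> _ _ [y ->] [y' ->]; exists (y * y'); rewrite rmorphM.
  by move=> _ [y ->] _; exists y^-1; rewrite fmorphV.
move=> Qx; have [|y Dx] := Qx _ imf.
  move=> w [[q ->]|/prim_expr_order/(prim_rootP zP)[i ->]].
    by exists (ratr q); rewrite fmorph_rat.
  by exists (zn ^+ i); rewrite rmorphXn /= Dz.
have : y \in <<1; zn>>%VS by rewrite -adjoin_seq1 genQn memvf.
case/Fadjoin_polyP => p /polyOverP p1 Dy.
have{p1} a_ i := sig_eqW (vlineP _ _ (p1 i)).
pose h : {poly rat} := \poly_(i < size p) sval (a_ i).
have Dp : map_poly QnC p = map_poly ratr h.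
  apply/polyP=> i; rewrite !coef_map coef_poly /=.
  case: ltnP => [_|/(nth_default 0) ->]; last by rewrite !rmorph0.
  by case: (a_ i) => b /= ->; rewrite alg_num_field fmorph_rat.
have [q [Dq q1] _] := minCpolyP z.
have q0 : q != 0 by apply: monic_neq0.
exists (h %% q).
  rewrite -ltnS; apply: leq_trans (ltn_modpN0 h q0) _.
  rewrite -(size_map_poly (ratr : {rmorphism rat -> algC}) q) -Dq (minCpoly_cyclotomic zP).
  by rewrite size_cyclotomic.
rewrite Dx Dy -horner_map Dp /= Dz {1}(divp_eq h q) rmorphD rmorphM /= -Dq.
by rewrite hornerD hornerM (eqP (root_minCpoly z)) mulr0 add0r.
Qed.

(** With [x = h(z)] and [x] fixed by every automorphism, [h - x] vanishes at all [totient n]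
    conjugates of [z]. Its size is at most [totient n], so it is zero and [x] is the constant
    coefficient of [h]. *)
Lemma Qcyc_fixed_rat n x : (0 < n)%N -> Qcyc n x -> (forall u, u x = x) -> ratC x.
Proof.
move=> n0 Qx fixx; have [z zP] := C_prim_root_exists n0.
have [h szh Dx] := Qcyc_poly zP Qx.
pose rs := [seq z ^+ i | i : 'I_n <- enum [pred i : 'I_n | coprime i n]].
have szr : size rs = totient n.
  by rewrite size_map -cardE totient_count_coprime -sum1_card big_mkcond big_mkord;
     apply: eq_bigr => i _; rewrite inE coprime_sym; case: ifP.
pose g : {poly algC} := map_poly ratr h - x%:P.
have /eqP: g == 0.
  have szp : (size g <= size rs)%N.
    rewrite szr (leq_trans (size_polyD _ _)) // geq_max size_polyN size_map_poly szh.
    by rewrite (leq_trans (size_polyC_leq1 _)) ?totient_gt0.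
  apply: contraLR szp => nz; rewrite -ltnNge; apply: max_poly_roots => //.
    apply/allP => y /mapP[i]; rewrite mem_enum inE => co_in ->{y}.
    have [u Du] := Qn_aut_exists co_in; apply/rootP.
    rewrite /g hornerD hornerN hornerC -Du ?prim_expr_order //.
    have <-: map_poly u (map_poly ratr h) = map_poly ratr h.
      by rewrite -map_poly_comp; apply: eq_map_poly => a; rewrite /= fmorph_rat.
    by rewrite horner_map /= -Dx fixx subrr.
  rewrite map_inj_in_uniq ?enum_uniq // => i j _ _ /eqP.
  by rewrite (eq_prim_root_expr zP) !modn_small // => /eqP/val_inj.
rewrite /g; move/eqP; rewrite subr_eq0 => /eqP Dh.
exists h`_0; have := congr1 (fun p : {poly algC} => p`_0) Dh.
by rewrite coef_map coefC.
Qed.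

(* The family sum_c c.1 (x) c.2 is the idempotent of K (x) K that cuts out the
   diagonal among the automorphisms us i, i \in r, and the identity. *)
Lemma galois_coordinates K (I : eqType) (us : I -> aut) (r : seq I) :
    is_subfield K -> (forall i y, K y -> K (us i y)) ->
    (forall i, i \in r -> exists2 y, K y & us i y != y) ->
  exists cs : seq (algC * algC),
    [/\ forall c, c \in cs -> K c.1 /\ K c.2,
        \sum_(c <- cs) c.1 * c.2 = 1 &
        forall i, i \in r -> \sum_(c <- cs) c.1 * us i c.2 = 0].
Proof.
move=> Kf Kus; elim: r => [|i r IHr] mvr.
  exists [:: (1, 1)]; split=> // [c|]; last by rewrite big_seq1 mulr1.
  by rewrite inE => /eqP->; split; apply: subfield1.
have [|cs [csK cs1 cs0]] := IHr; first by move=> j rj; apply: mvr; rewrite inE rj orbT.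
have [y Ky] := mvr i (mem_head _ _); rewrite -subr_eq0 -opprB oppr_eq0 => nz.
pose w := (y - us i y)^-1.
have Kuy := Kus i _ Ky.
have Kw : K w by apply: subfieldV => //; apply: subfieldD => //; apply: subfieldN.
(* Multiply the previous idempotent by w (1 (x) y - us i y (x) 1), which takes the value 1 at the
   identity and 0 at [us i]. *)
pose cs' := [seq (- (us i y * w * c.1), c.2) | c <- cs] ++ [seq (w * c.1, y * c.2) | c <- cs].
have cs'E (v : aut) : \sum_(c <- cs') c.1 * v c.2
    = w * (v y - us i y) * \sum_(c <- cs) c.1 * v c.2.
  rewrite big_cat !big_map /= -big_split mulr_sumr /=; apply: eq_bigr => c _.
  by rewrite rmorphM /=; ring.
exists cs'; split=> [c||j].
- rewrite mem_cat => /orP[] /mapP[b /csK[Kb1 Kb2] ->]; split=> //=.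
  + by apply: subfieldN => //; do 2!apply: subfieldM => //.
  + exact: subfieldM.
  + exact: subfieldM.
- by have := cs'E idfun; rewrite /= cs1 mulVf // mulr1.
rewrite inE cs'E => /predU1P[->|/cs0->]; last by rewrite mulr0.
by rewrite subrr mulr0 mul0r.
Qed.

(* The coordinates above express #|S| x as a K-combination of the rational numbers
   Tr (c.2 * x), where S is the set of exponents of automorphisms fixing K. *)
Lemma mem_fixed n K x : (0 < n)%N -> is_subfield K -> subc K (Qcyc n) ->
    (forall u y, K y -> K (u y)) -> Qcyc n x ->
    (forall u, (forall y, K y -> u y = y) -> u x = x) -> K x.
Proof.
move=> n0 Kf KQ Ku Qx fixx; have [z zP] := C_prim_root_exists n0.
(* The identity is a default value for [t] not prime to [n]; all later uses are restricted to [t]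
   prime to [n]. *)
have exu (t : 'I_n) : exists u : aut, coprime t n -> u z = z ^+ t.
  case: (boolP (coprime t n)) => [co_tn|_]; last by exists idfun.
  by have [u Du] := Qn_aut_exists co_tn; exists u; rewrite Du // prim_expr_order.
have [us Dus] := fin_all_exists exu.
pose S t := `[< forall y, K y -> us t y = y >].
pose Tr y := \sum_(t < n | coprime t n) us t y.
have QTr y : Qcyc n y -> ratC (Tr y).
  move=> Qy; apply: (@Qcyc_fixed_rat n) => // [|u].
    by apply: (subfield_sum (Qcyc_subfield n)) => i _; apply: aut_Qcyc.
  have [k co_kn Duz] := aut_prim_rootP u zP.
  pose h (t : 'I_n) := Ordinal (ltn_pmod (k * t) n0).
  have h_inj : injective h.
    move=> t t' /(congr1 val)/= /eqP; rewrite -(eq_prim_root_expr zP) !exprM -Duz.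
    rewrite -!rmorphXn (inj_eq (fmorph_inj u)) (eq_prim_root_expr zP).
    by rewrite !modn_small // => /eqP/val_inj.
  rewrite {2}/Tr (reindex_inj h_inj) rmorph_sum /=; apply: eq_big => t.
    by rewrite coprime_modl coprimeMl co_kn.
  move=> co_tn; apply: (eq_aut_Qcyc (u := u \o us t) zP) => //=.
  rewrite !Dus ?coprime_modl ?coprimeMl ?co_kn // rmorphXn Duz /= -exprM.
  by rewrite (prim_expr_mod zP).
have [|cs [csK cs1 cs0]] := @galois_coordinates K _ us
  (enum [pred t : 'I_n | coprime t n && ~~ S t]) Kf (fun i => Ku (us i)).
  move=> t; rewrite mem_enum inE => /andP[_ /asboolPn nfix].
  apply: contrapT => /forall2NP H; apply: nfix => y Ky.
  by case: (H y) => // /negP/negPn/eqP.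
pose N := #|[pred t : 'I_n | coprime t n && S t]|.
have Nx : N%:R * x = \sum_(c <- cs) c.1 * Tr (c.2 * x).
  transitivity (\sum_(t < n | coprime t n) us t x * \sum_(c <- cs) c.1 * us t c.2).
    rewrite mulr_natl -sumr_const big_mkcondr; apply: eq_bigr => t co_tn.
    case: ifPn => [/asboolP fixK|nSt]; last by rewrite cs0 ?mulr0 // mem_enum inE co_tn.
    rewrite fixx // -[LHS]mulr1; congr (_ * _); rewrite -cs1 !big_seq.
    by apply: eq_bigr => c /csK[_ Kc2]; rewrite fixK.
  transitivity (\sum_(c <- cs) \sum_(t < n | coprime t n) c.1 * us t (c.2 * x)).
    rewrite exchange_big /=; apply: eq_bigr => t _; rewrite mulr_sumr.
    by apply: eq_bigr => c _; rewrite rmorphM /=; ring.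
  by apply: eq_bigr => c _; rewrite mulr_sumr.
have N0 : N%:R != 0 :> algC.
  rewrite pnatr_eq0 -lt0n; apply/card_gt0P; exists (Ordinal (ltn_pmod 1 n0)).
  have co1 : coprime (Ordinal (ltn_pmod 1 n0)) n by rewrite /= coprime_modl coprime1n.
  rewrite inE co1; apply/asboolP => y /KQ Qy.
  rewrite (@eq_aut_Qcyc n z _ idfun zP) //= Dus //=.
  by rewrite (prim_expr_mod zP).
rewrite -(mulKf N0 x) Nx; apply: subfieldM => //; first by apply: subfieldV => //; apply: subfield_nat.
rewrite big_seq; apply: subfield_sum => // c /csK[Kc1 Kc2]; apply: subfieldM => //.
apply: (subfield_rat Kf); apply: QTr; apply: (subfieldM (Qcyc_subfield n)) => //.
exact: KQ.
Qed.
End Subfields.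

(** The family [us] represents Gal(F(z)/F). The matrix of the conjugates of a basis [s] has a left
    inverse, and its transpose too; both are built from [galois_coordinates], and they bound each of
    [d] and [#|I|] by the other. *)
Lemma is_degree_fixers n F N z d (I : finType) (us : I -> aut) :
    (0 < n)%N -> is_subfield F -> subc F (Qcyc n) ->
    (forall (u : aut) y, F y -> F (u y)) -> N.-primitive_root z ->
    (forall i y, F y -> us i y = y) -> injective (fun i => us i z) ->
    (forall u : aut, (forall y, F y -> u y = y) -> exists i, u z = us i z) ->
  is_degree F (cyc_ext F N) d -> d = #|I|.
Proof.
move=> n0 Ff FQ Fu zP usF us_inj us_all [s [<- sK s_free s_span]].
set K := cyc_ext F N in sK s_span.
have N0 := prim_order_gt0 zP.
have Kf : is_subfield K by apply: gen_subfield.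
have uK (u : aut) y : K y -> K (u y) by apply: aut_cyc => x; apply: Fu.
have nN0 : (0 < n * N)%N by rewrite muln_gt0 n0.
have FQ' : subc F (Qcyc (n * N)).
  by move=> y /FQ; apply: Qcyc_dvd => //; apply: dvdn_mulr.
have KQ : subc K (Qcyc (n * N)).
  apply: gen_min => [|y [/FQ' //|y1]]; first exact: Qcyc_subfield.
  apply: (@Qcyc_dvd N) => //; first exact: dvdn_mull.
  by apply: cyc_ext_unity; rewrite ?prim_expr_order.
have eqK (u v : aut) y : (forall x, F x -> u x = v x) -> u z = v z -> K y -> u y = v y.
  by move=> eqF eqz; apply: (eq_aut_cyc zP eqF eqz).
have [i0 Di0] := us_all idfun (fun y _ => erefl).
have us0 y : K y -> us i0 y = y.
  by move=> Ky; rewrite -(@eqK idfun (us i0)) //= => x Fx; rewrite usF.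
pose Tr y := \sum_i us i y.
have FTr y : K y -> F (Tr y).
  move=> Ky; apply: (@mem_fixed (n * N)) => // [|u uF].
    apply: (subfield_sum (Qcyc_subfield _)) => i _; by apply: KQ; apply: uK.
  have exh i : exists j, u (us i z) = us j z.
    by have [|j Dj] := us_all (u \o us i); [move=> x Fx /=; rewrite usF ?uF|exists j].
  have [h Dh] := fin_all_exists exh.
  have h_inj : injective h.
    by move=> i j ij; apply/us_inj/(fmorph_inj u); rewrite !Dh ij.
  rewrite /Tr rmorph_sum [RHS](reindex_inj h_inj) /=; apply: eq_bigr => i _.
  apply: (@eqK (u \o us i)) => // [x Fx|] /=; last by rewrite Dh.
  by rewrite !usF ?uF.
have [|cs [csK cs1 cs0]] := @galois_coordinates K _ us (enum [pred i | i != i0]) Kf (fun i => uK (us i)).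
  move=> i; rewrite mem_enum inE => ni0; exists z; first by apply: cyc_ext_unity; rewrite ?prim_expr_order.
  by rewrite [X in _ != X](Di0 : z = us i0 z) (inj_eq us_inj).
have cs_delta i : \sum_(c <- cs) c.1 * us i c.2 = (i == i0)%:R.
  case: eqVneq => [->|ni0]; last by rewrite cs0 // mem_enum.
  by rewrite -[RHS]cs1 !big_seq; apply: eq_bigr => c /csK[_ Kc2]; rewrite us0.
pose c l := tnth (in_tuple cs) l.
have Kc l : K (c l).1 /\ K (c l).2 by apply/csK/mem_tnth.
have [a Ha] := fin_all_exists (fun l => s_span _ (Kc l).1).
have [b Hb] := fin_all_exists (fun l => s_span _ (Kc l).2).
pose S := \matrix_(i < #|I|, j < size s) us (enum_val i) s`_j.
apply/eqP; rewrite eqn_leq; apply/andP; split.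
  (* The entries of [Y *m S] lie in F, being combinations of traces. Column [j] holds coordinates of
     [s_j] in the basis [s], so freeness identifies it with a column of the identity. *)
  pose Y := \matrix_(k < size s, i < #|I|) \sum_l a l k * us (enum_val i) (c l).2.
  apply: (@mulmx1_min _ _ _ Y S); apply/matrixP => k j; rewrite !mxE.
  pose e k := \sum_l a l k * Tr ((c l).2 * s`_j).
  have Fe k' : F (e k').
    apply: (subfield_sum Ff) => l _; apply: (subfieldM Ff); first by have [] := Ha l.
    by apply: FTr; apply: (subfieldM Kf); [case: (Kc l)|apply: sK].
  have De : \sum_k' (e k' - (k' == j)%:R) * s`_k' = 0.
    under eq_bigr do rewrite mulrBl; rewrite sumrB.
    have -> : \sum_(k' < size s) (k' == j)%:R * s`_k' = s`_j.
      rewrite (bigD1 j) //= eqxx mul1r big1 ?addr0 // => k' nk.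
      by rewrite (negbTE nk) mul0r.
    apply/eqP; rewrite subr_eq0; apply/eqP.
    transitivity (\sum_l (c l).1 * Tr ((c l).2 * s`_j)).
      under eq_bigr do rewrite mulr_suml; rewrite exchange_big; apply: eq_bigr => l _ /=.
      by rewrite {1}(Ha l).2 mulr_suml; apply: eq_bigr => k' _; ring.
    transitivity (\sum_i us i s`_j * \sum_(c <- cs) c.1 * us i c.2).
      rewrite -(big_tuple _ _ (in_tuple cs) xpredT (fun c => c.1 * Tr (c.2 * s`_j))) /=.
      under eq_bigr do rewrite mulr_sumr; rewrite exchange_big; apply: eq_bigr => i _ /=.
      by rewrite mulr_sumr; apply: eq_bigr => l _; rewrite rmorphM /=; ring.
    rewrite (bigD1 i0) //= cs_delta eqxx mulr1 (us0 _ (sK _ (ltn_ord j))) big1 ?addr0 // => i ni0.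
    by rewrite cs_delta (negbTE ni0) mulr0.
  have := s_free (fun k' => e k' - (k' == j)%:R) _ De k.
  have Fd k' : F (e k' - (k' == j)%:R).
    by apply: (subfieldD Ff) => //; apply/(subfieldN Ff)/(subfield_nat Ff).
  move=> /(_ Fd)/eqP; rewrite subr_eq0 => /eqP <-.
  rewrite /e; under eq_bigr do rewrite !mxE mulr_suml.
  rewrite exchange_big; apply: eq_bigr => l _ /=; rewrite mulr_sumr.
  rewrite [RHS](reindex (fun i : 'I_#|I| => enum_val i)) /=; last exact/onW_bij/enum_val_bij.
  by apply: eq_bigr => i _; rewrite rmorphM /= mulrA.
(* Entry (i, j) of [X *m S^T] is the image under [u] of the sum of the [c.1] times (u^-1 v)(c.2),
   which is 1 if [u] and [v] agree on F(z) and 0 otherwise. *)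
pose X := \matrix_(i < #|I|, k < size s) \sum_l us (enum_val i) (c l).1 * b l k.
apply: (@mulmx1_min _ _ _ X S^T); apply/matrixP => i j; rewrite !mxE.
set u := us (enum_val i); set v := us (enum_val j).
have [|k Dk] := us_all (algC_invaut u \o v).
  by move=> x Fx /=; apply: (fmorph_inj u); rewrite algC_invautK /u /v !usF.
transitivity (u (\sum_(c <- cs) c.1 * us k c.2)); last first.
  rewrite cs_delta rmorph_nat -(inj_eq us_inj) /= -Dk -Di0 /= -(inj_eq (fmorph_inj u)).
  by rewrite algC_invautK eq_sym (inj_eq us_inj) (inj_eq enum_val_inj).
rewrite rmorph_sum (big_tuple _ _ (in_tuple cs)) /=.
under eq_bigr do rewrite !mxE mulr_suml; rewrite exchange_big; apply: eq_bigr => l _ /=.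
rewrite rmorphM; have -> : u (us k (tnth (in_tuple cs) l).2) = v (c l).2.
  rewrite -[RHS](algC_invautK u); congr (u _); symmetry.
  apply: (@eqK (algC_invaut u \o v)) => // [x Fx|]; last exact: (Kc l).2.
  by rewrite usF //=; apply: (fmorph_inj u); rewrite algC_invautK /u /v !usF.
rewrite [in RHS](Hb l).2 rmorph_sum mulr_sumr; apply: eq_bigr => k' _.
by rewrite rmorphM /= (usF _ _ ((Hb l).1 k')) mulrA.
Qed.

(** * The Bruhat decomposition *)

Section Triangular.
Variables (R : fieldType) (n : nat).
Implicit Types A B g : 'M[R]_n.

Lemma trig_mulmx_diag A B i : is_trig_mx A -> is_trig_mx B ->
  (A *m B) i i = A i i * B i i.
Proof.
move=> /is_trig_mxP tA /is_trig_mxP tB; rewrite mxE (bigD1 i) //= big1 ?addr0 // => k.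
by rewrite neq_ltn => /orP[ltki|ltik]; [rewrite tB ?mulr0|rewrite tA ?mul0r].
Qed.

Lemma trig_mulmx A B : is_trig_mx A -> is_trig_mx B -> is_trig_mx (A *m B).
Proof.
move=> /is_trig_mxP tA /is_trig_mxP tB; apply/is_trig_mxP => i j ltij.
rewrite mxE big1 // => k _; case: (ltnP i k) => [ltik|leki]; first by rewrite tA ?mul0r.
by rewrite tB ?mulr0 ?(leq_ltn_trans leki).
Qed.

Lemma trig_unitmx A : is_trig_mx A -> (forall i, A i i != 0) -> A \in unitmx.
Proof. by move=> tA nzA; rewrite unitmxE det_trig // unitfE; apply/prodf_neq0. Qed.

Lemma unitmx_row_neq0 g (k : 'I_n) : g \in unitmx -> exists j, g k j != 0.
Proof.
move=> /mulmxV/matrixP/(_ k k); rewrite !mxE eqxx => sum1.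
apply/existsP; apply: contra_eqT sum1; rewrite negb_exists => /forallP gk0.
rewrite big1 1?eq_sym ?oner_eq0 // => j _.
by have /negPn/eqP-> := gk0 j; rewrite mul0r.
Qed.

(* Gaussian elimination, one row at a time, always pivoting on the last nonzero
   entry of the row, so that all the operations are lower triangular. *)
Lemma bruhat g : g \in unitmx ->
  exists b b' : 'M_n, exists s : 'S_n,
    [/\ is_trig_mx b, is_trig_mx b', b \in unitmx, b' \in unitmx &
        b *m g *m b' = perm_mx s].
Proof.
(* Row [i] and column [j] already look like those of a permutation matrix, with their only nonzero
   entry, 1, where they meet. *)
move=> Ug; pose cleared (h : 'M[R]_n) i j := (forall j', h i j' = (j' == j)%:R :> R) /\
                                 (forall i', h i' j = (i' == i)%:R :> R).
have main k : (k <= n)%N -> exists b b' : 'M_n,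
    [/\ is_trig_mx b, is_trig_mx b', b \in unitmx, b' \in unitmx &
        forall i : 'I_n, (i < k)%N -> exists j, cleared (b *m g *m b') i j].
  elim: k => [|k IHk] ltkn.
    by exists 1%:M, 1%:M; split; rewrite ?unitmx1 ?scalar_mx_is_trig.
  have [b [b' [tb tb' Ub Ub' clr]]] := IHk (ltnW ltkn).
  have [h Dh] : {h | b *m g *m b' = h} by exists (b *m g *m b').
  rewrite Dh in clr.
  have Uh : h \in unitmx by rewrite -Dh !unitmx_mul Ub Ug.
  pose k0 := Ordinal ltkn.
  have [j0 nz0] := unitmx_row_neq0 k0 Uh.
  have [j nzj maxj] := @arg_maxnP _ j0 (fun j => h k0 j != 0) val nz0.
  have hk0 (j' : 'I_n) : (j < j')%N -> h k0 j' = 0.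
    by move=> ltj; apply: contraTeq ltj => /maxj; rewrite -leqNgt.
  have hij (i : 'I_n) : (i < k)%N -> h i j = 0.
    move=> ltik; have [l [hil hli]] := clr i ltik; rewrite hil.
    case: (eqVneq j l) => [Dl|_]; last by [].
    by move: nzj; rewrite Dl hli -val_eqE /= gtn_eqF // eqxx.
  (* Right multiplication by [b2] adds multiples of column [j] to make row [k0] a unit vector; [r]
     vanishes beyond [j] by the choice of the pivot. Left multiplication by [b1] then clears column
     [j] with row [k0]; [c] vanishes up to row [k0] because the earlier rows are zero in column
     [j]. *)
  pose r : 'rV[R]_n := \row_j' (((j' == j)%:R - h k0 j') / h k0 j).
  pose c : 'cV[R]_n := \col_i ((i == k0)%:R - (h *m (1%:M + delta_mx j 0 *m r)) i j).
  pose b2 : 'M_n := 1%:M + delta_mx j 0 *m r.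
  pose b1 : 'M_n := 1%:M + c *m delta_mx 0 k0.
  have b2E i j' : b2 i j' = (i == j')%:R + (i == j)%:R * r 0 j'.
    by rewrite !mxE big_ord1 !mxE eqxx andbT.
  have b1E i j' : b1 i j' = (i == j')%:R + c i 0 * (j' == k0)%:R.
    by rewrite !mxE big_ord1 !mxE eqxx.
  have h2E i j' : (h *m b2) i j' = h i j' + h i j * r 0 j'.
    by rewrite mulmxDr mulmx1 mulmxA -colE mxE [in LHS]mxE big_ord1 mxE.
  have h1E i j' : (b1 *m (h *m b2)) i j' = (h *m b2) i j' + c i 0 * (h *m b2) k0 j'.
    by rewrite mulmxDl mul1mx -mulmxA -rowE mxE [X in _ + X]mxE big_ord1 [row _ _ _ _]mxE.
  have h2k j' : (h *m b2) k0 j' = (j' == j)%:R.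
    by rewrite h2E mxE mulrC divfK // addrC subrK.
  have h2i (i j' : 'I_n) : (i < k)%N -> (h *m b2) i j' = h i j'.
    by move=> ltik; rewrite h2E hij // mul0r addr0.
  have cE i : c i 0 = (i == k0)%:R - (h *m b2) i j by rewrite mxE.
  have c0 (i : 'I_n) : (i <= k)%N -> c i 0 = 0.
    rewrite leq_eqVlt => /predU1P[Di|ltik].
      by rewrite cE (_ : i = k0) ?h2k ?eqxx ?subrr //; apply: val_inj.
    by rewrite cE h2i // hij // -val_eqE /= ltn_eqF // subrr.
  exists (b1 *m b), (b' *m b2).
  have tb1 : is_trig_mx b1.
    apply/is_trig_mxP => i i' lti; rewrite b1E -val_eqE ltn_eqF // add0r.
    case: (eqVneq i' k0) lti => [->|_] lti; last by rewrite mulr0.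
    by rewrite c0 ?mul0r // ltnW.
  have tb2 : is_trig_mx b2.
    apply/is_trig_mxP => i i' lti; rewrite b2E -val_eqE ltn_eqF // add0r.
    case: (eqVneq i j) lti => [->|_] lti; last by rewrite mul0r.
    by rewrite mxE hk0 // -val_eqE gtn_eqF // subrr mul0r mulr0.
  have Ub1 : b1 \in unitmx.
    apply: trig_unitmx => // i; rewrite b1E eqxx.
    by case: (eqVneq i k0) => [->|_]; [rewrite c0 // mul0r|rewrite mulr0]; rewrite addr0 oner_eq0.
  have Ub2 : b2 \in unitmx.
    apply: trig_unitmx => // i; rewrite b2E eqxx.
    case: (eqVneq i j) => [->|_]; last by rewrite mul0r addr0 oner_eq0.
    by rewrite mxE eqxx mul1r mulrBl divff // addrC subrK mul1r invr_eq0.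
  have -> : b1 *m b *m g *m (b' *m b2) = b1 *m (h *m b2) by rewrite -Dh !mulmxA.
  split; rewrite ?unitmx_mul ?Ub1 ?Ub2 ?Ub ?Ub' ?trig_mulmx // => i.
  rewrite ltnS leq_eqVlt => /predU1P[Di|ltik].
    have -> : i = k0 by apply: val_inj.
    exists j; split=> x; first by rewrite h1E c0 // mul0r addr0 h2k.
    by rewrite h1E h2k eqxx mulr1 cE addrC subrK.
  have [l [hil hli]] := clr i ltik; have nlj : l != j.
    by apply/eqP => Dl; have := hil l; rewrite Dl hij // eqxx => /eqP; rewrite eq_sym oner_eq0.
  have nik : k0 != i by rewrite -val_eqE /= gtn_eqF.
  exists l; split=> x; first by rewrite h1E h2i // (c0 _ (ltnW ltik)) mul0r addr0.
  rewrite h1E h2k (negbTE nlj) mulr0 addr0 h2E hli mxE hli (negbTE nlj) (negbTE nik).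
  by rewrite subr0 mul0r mulr0 addr0.
have [b [b' [tb tb' Ub Ub' clr]]] := main n (leqnn n).
have [f clrf] := fin_all_exists (fun i : 'I_n => clr i (ltn_ord i)).
have f_inj : injective f.
  move=> i i' ff; have [_ /(_ i')] := clrf i; rewrite ff.
  have [_ ->] := clrf i'; rewrite eqxx => /eqP.
  by case: (eqVneq i' i) => //= _; rewrite oner_eq0.
exists b, b', (perm f_inj); split=> //; apply/matrixP => i j.
by have [-> _] := clrf i; rewrite !mxE permE eq_sym.
Qed.
End Triangular.

(** * The Borel subgroup of the general linear group over a finite field *)

Section Borel.
Variables (F : finFieldType) (n : nat).
Local Notation GL := {'GL_n.+1[F]}.

Definition borel := [set g : GL | is_trig_mx (val g)].

Fact borel_group_set : group_set borel.
Proof.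
apply/group_setP; split=> [|g h]; first by rewrite inE scalar_mx_is_trig.
by rewrite !inE => tg th; apply: trig_mulmx.
Qed.
Canonical borel_group := Group borel_group_set.

Definition permGL (s : 'S_n.+1) : GL := Sub (perm_mx s) (unitmx_perm _ s).

Lemma bruhatGL (g : GL) : exists b b' s,
  [/\ b \in borel, b' \in borel & (b * g * b')%g = permGL s].
Proof.
have [b [b' [s [tb tb' Ub Ub' Dg]]]] := bruhat (valP g).
exists (Sub b Ub), (Sub b' Ub'), s; rewrite !inE; split=> //.
exact: val_inj.
Qed.

(** A lower triangular invertible matrix is a free choice of entries satisfying [S]; each of the
    'C(n+1, 2) positions below the diagonal contributes a factor [#|F|]. *)
Lemma card_borel_dvdn : (#|F| ^ 'C(n.+1, 2) %| #|borel|)%N.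
Proof.
pose S (x : 'I_n.+1 * 'I_n.+1) : pred F := fun a =>
  if (x.1 < x.2)%N then a == 0 else (x.1 == x.2) ==> (a != 0).
pose f (g : GL) : {ffun 'I_n.+1 * 'I_n.+1 -> F} := [ffun x => val g x.1 x.2].
have f_inj : injective f.
  move=> g h /ffunP fgh; apply/val_inj/matrixP => i j.
  by have := fgh (i, j); rewrite !ffunE.
have -> : #|borel| = #|family S|.
  rewrite -(card_imset _ f_inj); apply: eq_card => w; apply/imsetP/familyP.
    case=> g; rewrite inE => tg -> -[i j]; rewrite ffunE unfold_in /S /=.
    case: ifP => [ltij|_]; first by rewrite (is_trig_mxP tg).
    apply/implyP => /eqP <-; have := GL_unitmx g; rewrite unitmxE det_trig // unitfE.
    by move/prodf_neq0; apply.
  move=> Sw; pose A := \matrix_(i, j) w (i, j).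
  have tA : is_trig_mx A.
    by apply/is_trig_mxP => i j ltij; have := Sw (i, j); rewrite unfold_in /S /= ltij mxE => /eqP.
  have UA : A \in unitmx.
    apply: trig_unitmx => // i; have := Sw (i, i).
    by rewrite unfold_in /S /= ltnn eqxx mxE.
  exists (Sub A UA : GL); first by rewrite inE.
  by apply/ffunP => -[i j]; rewrite ffunE mxE.
rewrite card_family foldrE big_image /= -(pair_bigA _ (fun i j => #|S (i, j)|)) /=.
rewrite -bin2_sum big_mkord expn_sum; apply: (big_ind2 (fun a b => a %| b)%N) => //.
  by move=> a b c d; apply: dvdn_mul.
move=> i _; rewrite (bigID (fun j : 'I_n.+1 => (j < i)%N)) /=; apply: dvdn_mulr.
rewrite (eq_bigr (fun=> #|F|)) => [|j ltji]; last first.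
  by apply: eq_card => a; rewrite unfold_in /S /= -val_eqE /= gtn_eqF // ltnNge ltnW.
by rewrite prod_nat_const -sum1_card (big_ord_narrow (ltnW (ltn_ord i))) /= sum_nat_const card_ord muln1.
Qed.

(** In the order formula for GL the factors q^i - 1 are prime to p, so the p-part is that of
    q^'C(n+1, 2), which already divides the order of the Borel subgroup. *)
Lemma logn_card_borel p k : prime p -> #|F| = (p ^ k)%N ->
  logn p #|borel| = logn p #|[set: GL]|.
Proof.
move=> p_pr cF; apply/eqP; rewrite eqn_leq; apply/andP; split.
  by apply: dvdn_leq_log; rewrite ?cardG_gt0 // cardSg ?subsetT.
have k0 : (0 < k)%N by case: k cF (finNzRing_gt1 F) => // ->.
have co : coprime p (\prod_(1 <= i < n.+2) (#|F| ^ i - 1)).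
  rewrite big_nat; apply: (big_ind (coprime p)) => [|a b|i /andP[i0 _]].
  - exact: coprimen1.
  - by rewrite coprimeMr => ->.
  have q0 : (0 < #|F| ^ i)%N by rewrite expn_gt0 (ltnW (finNzRing_gt1 F)).
  rewrite prime_coprime //; apply/negP => dvp.
  have : (p %| #|F| ^ i - 1 + 1)%N by rewrite subnK // cF -expnM dvdn_exp // muln_gt0 k0.
  by rewrite dvdn_addr // dvdn1 => /eqP p1; rewrite p1 in p_pr.
rewrite (card_GL F (ltn0Sn n)) lognM ?expn_gt0 ?(ltnW (finNzRing_gt1 F)) //.
  by rewrite (logn_coprime co) addn0; apply/dvdn_leq_log/card_borel_dvdn; rewrite ?cardG_gt0.
by case: posnP co => // ->; rewrite /coprime gcdn0 => /eqP p1; rewrite p1 in p_pr.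
Qed.
End Borel.

(** * Induced linear characters *)

Section Mackey.
Variables (gT : finGroupType) (G D : {group gT}).
Hypothesis sDG : D \subset G.
Implicit Types theta eta : 'CF(D).

(** On the intersection of [D] with its conjugate by [g^-1], [theta] coincides with the conjugate of
    [eta] by [g]. *)
Definition agree theta eta g := forall x y, x \in D -> y \in D ->
  (x * g = g * y)%g -> theta x = eta y.

(** As [eta] vanishes off [D], this is the order of [D :&: D :^ g^-1] times the inner product on it
    of [theta] with the conjugate of [eta] by [g]. *)
Definition mackey_term theta eta (g : gT) :=
  \sum_(x in D) theta x * (eta (x ^ g)%g)^*.

Lemma cfdot_Ind theta eta : '['Ind[G] theta, 'Ind[G] eta]
  = #|D|%:R^-1 * #|D|%:R^-1 * \sum_(g in G) mackey_term theta eta g.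
Proof.
rewrite -Frobenius_reciprocity cfdotE -!mulrA; congr (_ * _).
rewrite exchange_big /= mulr_sumr; apply: eq_bigr => x Dx.
rewrite cfResE // cfIndE // rmorphM /= fmorphV rmorph_nat rmorph_sum /=.
by rewrite mulrCA mulr_sumr.
Qed.

Lemma mackey_term_agree theta eta g : theta \is a linear_char -> eta \is a linear_char ->
  agree theta eta g -> mackey_term theta eta g = #|D :&: (D :^ g^-1)%g|%:R.
Proof.
move=> Lt Le agr; rewrite -sumr_const /mackey_term (bigID [in (D :^ g^-1)%g]) /=.
rewrite addrC big1 ?add0r => [|x /andP[_]]; last first.
  by rewrite mem_conjgV => Dxg; rewrite (cfun0 eta Dxg) conjC0 mulr0.
apply: eq_big => x; rewrite ?in_setI // mem_conjgV => /andP[Dx Dxg].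
by rewrite -(agr x (x ^ g)%g Dx Dxg (conjgC x g)) -normCK normC_lin_char // expr1n.
Qed.

(** Translating the summation variable by a witness [x] of disagreement multiplies the sum by
    [theta x * (eta y)^*], which differs from 1. *)
Lemma mackey_term_disagree theta eta g : theta \is a linear_char -> eta \is a linear_char ->
  ~ agree theta eta g -> mackey_term theta eta g = 0.
Proof.
move=> Lt Le nagr.
have [x [y [Dx Dy xgy neq]]] : exists x y, [/\ x \in D, y \in D, (x * g = g * y)%g & theta x != eta y].
  apply: contrapT => nex; apply: nagr => x y Dx Dy xgy; apply/eqP.
  by apply: contrapT => /negP neq; apply: nex; exists x, y.
have Dxg : (x ^ g)%g = y by rewrite conjgE xgy mulKg.
have : mackey_term theta eta g = theta x * (eta y)^* * mackey_term theta eta g.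
  rewrite {1}/mackey_term (reindex_inj (mulgI x)) /= mulr_sumr; apply: eq_big => w.
    by rewrite groupMl.
  rewrite groupMl // => Dw; rewrite lin_charM // conjMg Dxg.
  case: (boolP ((w ^ g)%g \in D)) => [Dwg|nDwg].
    by rewrite lin_charM // rmorphM /=; ring.
  have nDyw : (y * w ^ g)%g \notin D by rewrite groupMl.
  by rewrite (cfun0 eta nDyw) (cfun0 eta nDwg) conjC0 !mulr0.
move/eqP; rewrite -subr_eq0 -{1}[mackey_term _ _ _]mul1r -mulrBl mulf_eq0.
case/orP=> [|/eqP //]; rewrite subr_eq0 => /eqP Dxy; case/eqP: neq.
rewrite -[RHS]mul1r Dxy -mulrA [_^* * _]mulrC -normCK normC_lin_char // expr1n.
by rewrite mulr1.
Qed.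

Lemma cfdot_Ind_eq0 theta eta : theta \is a linear_char -> eta \is a linear_char ->
  (forall g, g \in G -> ~ agree theta eta g) -> '['Ind[G] theta, 'Ind[G] eta] = 0.
Proof.
by move=> Lt Le nagr; rewrite cfdot_Ind big1 ?mulr0 // => g /nagr; apply: mackey_term_disagree.
Qed.

(** All Mackey terms are nonnegative, and the one at [g0] is positive. *)
Lemma cfdot_Ind_neq0 theta eta g0 : theta \is a linear_char -> eta \is a linear_char ->
  g0 \in G -> agree theta eta g0 -> '['Ind[G] theta, 'Ind[G] eta] != 0.
Proof.
move=> Lt Le Gg0 agr0; rewrite cfdot_Ind !mulf_neq0 ?invr_eq0 ?neq0CG //.
rewrite (bigD1 g0) //= gt_eqF // ltr_wpDr ?mackey_term_agree //.
  apply: sumr_ge0 => g _; have [agr|nagr] := pselect (agree theta eta g).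
    by rewrite mackey_term_agree.
  by rewrite mackey_term_disagree.
by rewrite ltr0n cardG_gt0.
Qed.

(** Only the terms with [g] in [D] survive, each equal to [#|D|], so the induced character has norm
    1. *)
Lemma Ind_irr theta : theta \is a linear_char ->
  (forall g, g \in G -> agree theta theta g -> g \in D) -> 'Ind[G] theta \in irr G.
Proof.
move=> Lt agrD; rewrite irrEchar cfInd_char ?lin_charW //=.
rewrite cfdot_Ind (bigID [in D]) /= [X in _ + X]big1 ?addr0 => [|g /andP[Gg nDg]]; last first.
  by apply: mackey_term_disagree => // /(agrD g Gg) Dg; rewrite Dg in nDg.
rewrite (eq_bigr (fun=> #|D|%:R)) => [|g /andP[_ Dg]]; last first.
  rewrite mackey_term_agree //; first by rewrite conjGid ?groupV // setIid.
  move=> x y Dx Dy xgy; have : theta (x * g)%g = theta (g * y)%g by rewrite xgy.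
  by rewrite !lin_charM // mulrC => /(mulfI (lin_char_neq0 Lt Dg)).
rewrite (eq_bigl [in D]) => [|g]; last by rewrite andb_idl //; apply/subsetP.
by rewrite sumr_const -[X in _ * X]mulr_natr mulrACA !mulVf ?neq0CG ?mulr1.
Qed.
End Mackey.

Section MulChar.
Variables (gT : finGroupType) (D : {group gT}) (f : gT -> algC).
Hypotheses (f1 : f 1%g = 1) (fM : {in D &, {morph f : x y / (x * y)%g >-> x * y}}).

Lemma mulchar_repr : mx_repr D (fun x => (f x)%:M : 'M_1).
Proof. by split=> [|x y Dx Dy]; rewrite ?f1 // fM // scalar_mxM. Qed.

Definition mulchar := cfRepr (MxRepresentation mulchar_repr).

Lemma mulchar_lin : mulchar \is a linear_char.
Proof. by rewrite qualifE /= cfRepr_char cfRepr1 eqxx. Qed.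

Lemma mulcharE x : x \in D -> mulchar x = f x.
Proof. by move=> Dx; rewrite cfunE Dx mulr1n mxtrace_scalar mulr1n. Qed.
End MulChar.

(** An automorphism raises the roots of unity of order dividing [#[g]] to some power [k], so it
    sends [chi g] to [chi (g ^+ k)]. Hence a field of values is stable under automorphisms. *)
Lemma char_aut (gT : finGroupType) (G : {group gT}) (chi : 'CF(G)) (u : aut) g :
  chi \is a character -> exists h, u (chi g) = chi h.
Proof.
move=> Nchi; have [Gg|/cfun0 chig0] := boolP (g \in G); last first.
  by exists g; rewrite chig0 rmorph0.
have [z zP] := C_prim_root_exists (order_gt0 g).
have [k _ Duz] := aut_prim_rootP u zP.
exists (g ^+ k)%g; have sgG : (<[g]> \subset G)%g by rewrite cycle_subG.
have gg := cycle_id g; have ggk := mem_cycle g k.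
rewrite -!(cfResE _ sgG) //.
have [r ->] := char_sum_irr (cfRes_char <[g]>%g Nchi).
rewrite !sum_cfunE rmorph_sum; apply: eq_bigr => i _.
have Li : 'chi_i \is a linear_char by rewrite irr_cyclic_lin ?cycle_cyclic.
have /(prim_rootP zP)[m Dm] : 'chi_i g ^+ #[g]%g = 1.
  by rewrite -lin_charX // expg_order lin_char1.
by rewrite lin_charX // Dm rmorphXn Duz exprAC.
Qed.

(** * The group and its linear character *)

Section DoubleCoset.
Variables (H : finGroupType) (B : {group H}).

Lemma mem_double_coset (b h b' : H) : b \in B -> b' \in B -> (b * h * b')%g \in B -> h \in B.
Proof. by move=> Bb Bb'; rewrite groupMr // groupMl. Qed.

(** Conjugation inside [B] does not change [chi] or [psi], so agreement along [h] passes to any [w]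
    in its double coset, in particular to the permutation matrix given by Bruhat. *)
Lemma char_double_coset (chi psi : H -> algC) (b h b' w d d' : H) :
    chi 1%g = 1 -> psi 1%g = 1 ->
    {in B &, {morph chi : x y / (x * y)%g >-> x * y}} ->
    {in B &, {morph psi : x y / (x * y)%g >-> x * y}} ->
    (forall x y, x \in B -> y \in B -> (x * h = h * y)%g -> chi x = psi y) ->
    b \in B -> b' \in B -> (b * h * b')%g = w ->
  d \in B -> d' \in B -> (d' * w = w * d)%g -> chi d' = psi d.
Proof.
move=> chi1 psi1 chiM psiM agr Bb Bb' Dw Bd Bd' dw.
have BV x : x \in B -> (x^-1)%g \in B by rewrite groupV.
have conjE f x c : f 1%g = 1 :> algC -> {in B &, {morph f : x y / (x * y)%g >-> x * y}} ->
    x \in B -> c \in B -> f (c^-1 * x * c)%g = f x.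
  move=> f1 fM Bx Bc; have BcV := BV c Bc.
  by rewrite !fM ?groupM // mulrAC -fM // mulVg f1 mul1r.
rewrite -(conjE chi d' b) // -(conjE psi d b'^-1%g) ?BV // invgK.
apply: agr; rewrite ?groupM ?BV //.
have -> : h = (b^-1 * w * b'^-1)%g by rewrite -Dw !mulgA mulVg mul1g mulgK.
by rewrite !mulgA mulgK mulgKV -(mulgA _ d') dw !mulgA.
Qed.
End DoubleCoset.

(** * Characters of the diagonal torus, extended to the Borel subgroup *)

Section TorusCharacter.
Variables (Fq : finFieldType) (n : nat).
Local Notation GL := {'GL_n.+1[Fq]}.
Implicit Types (l : 'I_n.+1 -> Fq -> algC).

Definition mulfam l := (forall i, l i 1 = 1) /\ (forall i, {morph l i : a b / a * b}).

Definition torchar l (g : GL) := \prod_i l i (val g i i).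

Lemma torchar1 l : mulfam l -> torchar l 1%g = 1.
Proof. by case=> l1 _; rewrite /torchar big1 // => i _; rewrite mxE eqxx l1. Qed.

Lemma torcharM l : mulfam l ->
  {in borel Fq n &, {morph torchar l : g h / (g * h)%g >-> g * h}}.
Proof.
case=> _ lM g h; rewrite !inE => tg th; rewrite /torchar -big_split /=.
by apply: eq_bigr => i _; rewrite trig_mulmx_diag // lM.
Qed.

Fact diag_unitmx (j : 'I_n.+1) (a : {unit Fq}) :
  diag_mx (\row_i (if i == j then val a else 1)) \in unitmx.
Proof.
rewrite unitmxE det_diag unitfE; apply/prodf_neq0 => i _; rewrite mxE.
by case: ifP => _; [rewrite -unitfE (valP a)|apply: oner_neq0].
Qed.

Definition diagGL j a : GL := Sub (diag_mx _) (diag_unitmx j a).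

Lemma diagGL_borel j a : diagGL j a \in borel Fq n.
Proof. by rewrite inE diag_mx_is_trig. Qed.

Lemma torchar_diag l j a : mulfam l -> torchar l (diagGL j a) = l j (val a).
Proof.
case=> l1 _; rewrite /torchar (bigD1 j) //= big1 => [|i nij].
  by rewrite !mxE !eqxx mulr1 mulr1n.
by rewrite !mxE eqxx (negbTE nij) mulr1n l1.
Qed.

Lemma permGL_diag (s : 'S_n.+1) (j : 'I_n.+1) (a : {unit Fq}) :
  (diagGL (s^-1 j) a * permGL Fq s = permGL Fq s * diagGL j a)%g.
Proof.
pose D i := diag_mx (\row_k (if k == i then val a else 1)) : 'M[Fq]_n.+1.
suff E : D (s^-1 j)%g *m perm_mx s = perm_mx s *m D j by apply: val_inj.
apply/matrixP => i k; rewrite mul_mx_diag mul_diag_mx !mxE mulrC.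
case: (eqVneq (s i) k) => [Dk|_]; last by rewrite !mul0r.
by rewrite -Dk -(inj_eq (@perm_inj _ s)) permKV.
Qed.

(** Move [h] to a permutation matrix by Bruhat, then test agreement on diagonal matrices with a
    single nontrivial entry: the matrix permutes these, so the components of [l] and [l'] match up
    to a permutation. *)
Lemma agree_torchar (u : aut) l l' (h : GL) : mulfam l -> mulfam l' ->
    (forall x y, x \in borel Fq n -> y \in borel Fq n -> (x * h = h * y)%g ->
       torchar l' x = u (torchar l y)) ->
  exists s : 'S_n.+1, (forall i (a : {unit Fq}), u (l i (val a)) = l' (s i) (val a)) /\
    (s = 1%g -> h \in borel Fq n).
Proof.
move=> lP l'P agr; have [b [b' [s [Bb Bb' Dh]]]] := bruhatGL h.
exists s^-1%g; split=> [i a|/eqP]; last first.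
  rewrite eq_invg1 => /eqP s1; apply: (@mem_double_coset _ (borel_group Fq n) _ _ _ Bb Bb').
  by rewrite Dh s1 inE /= perm_mx1 scalar_mx_is_trig.
rewrite -(torchar_diag (s^-1 i)%g a l'P) -(torchar_diag i a lP); symmetry.
apply: (@char_double_coset _ (borel_group Fq n) (torchar l') (u \o torchar l) b h b' (permGL Fq s)) => //=.
- exact: torchar1.
- by rewrite torchar1 ?rmorph1.
- exact: torcharM.
- by move=> x y Bx By; rewrite /= torcharM ?rmorphM.
- exact: diagGL_borel.
- exact: diagGL_borel.
exact: permGL_diag.
Qed.

(** Triangular matrices [x] and [y] related by a permutation matrix have the same diagonal up to
    that permutation, and [torchar] sees only the diagonal. *)
Lemma torchar_agree (u : aut) l l' (s : 'S_n.+1) :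
    (forall i (a : {unit Fq}), u (l i (val a)) = l' (s i) (val a)) ->
  forall x y, x \in borel Fq n -> y \in borel Fq n ->
    (x * permGL Fq s^-1 = permGL Fq s^-1 * y)%g -> torchar l' x = u (torchar l y).
Proof.
move=> Dl x y Bx; rewrite inE => ty xy.
rewrite /torchar rmorph_prod (reindex_inj (@perm_inj _ s)); apply: eq_bigr => i _ /=.
have Uy : val y i i \is a GRing.unit.
  have := GL_unitmx y; rewrite unitmxE det_trig // unitfE => /prodf_neq0/(_ i isT).
  by rewrite unitfE.
have -> : val x (s i) (s i) = val y i i.
  have /matrixP/(_ (s i) i) : val x *m perm_mx s^-1 = perm_mx s^-1 *m val y by apply: (congr1 val xy).
  by rewrite -col_permE -row_permE [in LHS]mxE mxE permK.
by have /= <- := Dl i (FinRing.unit Fq Uy).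
Qed.
End TorusCharacter.

(** * The semidirect product and the linear character of its Borel subgroup *)

Section Wreath.
Variables (GL : finGroupType) (B : {group GL}) (N : nat) (A : {group {unit 'Z_N}}).
Local Notation aT := (subg_of A).

(* Triples (c, f, s) stand for (c, f) s in the semidirect product ('Z_N x GL^A) : A. *)
Definition wreath : Type := 'Z_N * {ffun aT -> GL} * aT.

HB.instance Definition _ := Finite.on wreath.

Definition act_unit (s : aT) : 'Z_N := val (sgval s).

Lemma act_unitM s t : act_unit (s * t)%g = act_unit s * act_unit t.
Proof. by []. Qed.

Lemma act_unit1 : act_unit 1%g = 1. Proof. by []. Qed.

Lemma act_unit_inj : injective act_unit.
Proof. by move=> s t /val_inj/val_inj. Qed.

Definition wreath_mul (x y : wreath) : wreath :=
  (x.1.1 + act_unit x.2 * y.1.1, [ffun k => x.1.2 k * y.1.2 (x.2^-1 * k)]%g, (x.2 * y.2)%g).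
Definition wreath_one : wreath := (0, [ffun=> 1%g], 1%g).
Definition wreath_inv (x : wreath) : wreath :=
  (- (act_unit x.2^-1%g * x.1.1), [ffun k => (x.1.2 (x.2 * k))^-1]%g, x.2^-1%g).

Fact wreath_mulA : associative wreath_mul.
Proof.
move=> [[u f] s] [[v g] t] [[w h] r]; rewrite /wreath_mul /=; congr (_, _, _).
- by rewrite act_unitM mulrDr mulrA addrA.
- by apply/ffunP => k; rewrite !ffunE invMg !mulgA.
exact: mulgA.
Qed.

Fact wreath_mul1 : left_id wreath_one wreath_mul.
Proof.
move=> [[u f] s]; rewrite /wreath_mul /=; congr (_, _, _).
- by rewrite act_unit1 mul1r add0r.
- by apply/ffunP => k; rewrite !ffunE invg1 !mul1g.
exact: mul1g.
Qed.

Fact wreath_mulV : left_inverse wreath_one wreath_inv wreath_mul.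
Proof.
move=> [[u f] s]; rewrite /wreath_mul /=; congr (_, _, _).
- by rewrite addNr.
- by apply/ffunP => k; rewrite !ffunE invgK mulVg.
exact: mulVg.
Qed.

HB.instance Definition _ := Finite_isGroup.Build wreath wreath_mulA wreath_mul1 wreath_mulV.

Lemma wreathM (x y : wreath) : (x * y)%g = wreath_mul x y. Proof. by []. Qed.

Definition wborel : {set wreath} :=
  [set x : wreath | (x.2 == 1%g) && [forall k, x.1.2 k \in B]].

Lemma wborelP (x : wreath) : reflect (x.2 = 1%g /\ forall k, x.1.2 k \in B) (x \in wborel).
Proof. by rewrite inE; apply: (iffP andP) => -[/eqP ? /forallP ?]. Qed.

Fact wborel_group_set : group_set wborel.
Proof.
apply/group_setP; split=> [|x y].
  by apply/wborelP; split=> // k; rewrite ffunE group1.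
move=> /wborelP[x1 Bx] /wborelP[y1 By]; apply/wborelP; rewrite wreathM /wreath_mul x1 y1.
split=> [|k]; first exact: mulg1.
by rewrite ffunE; apply: (groupM ).
Qed.
Canonical wborel_group := Group wborel_group_set.

Lemma logn_index_wborel p : logn p #|B| = logn p #|[set: GL]| ->
  logn p #|[set: wreath] : wborel|%g = logn p #|A|.
Proof.
move=> eqB; have cA : #|{: aT}| = #|A| by rewrite card_sub.
have cD : #|wborel| = (#|{: 'Z_N}| * #|B| ^ #|A|)%N.
  have -> : wborel = setX (setX [set: 'Z_N] [set f : {ffun aT -> GL} | f \in ffun_on (mem B)]) [set 1%g].
    by apply/setP => -[[u f] s]; rewrite !inE /= andbC; congr (_ && _).
  by rewrite !cardsX cards1 muln1 cardsT cardsE card_ffun_on cA.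
have := Lagrange (subsetT wborel_group).
rewrite cardsT !card_prod card_ffun cA [#|wborel_group|]cD => /(congr1 (logn p)).
have N0 : (0 < #|{: 'Z_N}|)%N by rewrite card_ord.
rewrite !lognM ?muln_gt0 ?expn_gt0 ?cardG_gt0 ?N0 -?cardsT ?cardG_gt0 //.
by rewrite !lognX eqB => /eqP; rewrite eqn_add2l => /eqP.
Qed.

Variables (z : algC) (chi : aT -> GL -> algC).
Hypothesis zP : (Zp_trunc N).+2.-primitive_root z.
Hypotheses (chi1 : forall k, chi k 1%g = 1)
  (chiM : forall k, {in B &, {morph chi k : x y / (x * y)%g >-> x * y}}).

Definition wchar (x : wreath) := z ^+ x.1.1 * \prod_k chi k (x.1.2 k).

Lemma wchar1 : wchar 1%g = 1.
Proof. by rewrite /wchar expr0 mul1r big1 // => k _; rewrite ffunE chi1. Qed.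

Lemma wcharM : {in wborel &, {morph wchar : x y / (x * y)%g >-> x * y}}.
Proof.
move=> x y /wborelP[x1 Bx] /wborelP[y1 By].
have -> : (x * y)%g = (x.1.1 + y.1.1, [ffun k => x.1.2 k * y.1.2 k]%g, 1%g).
  rewrite wreathM /wreath_mul x1 y1 act_unit1 mul1r; congr (_, _, _); last exact: mul1g.
  by apply/ffunP => k; rewrite !ffunE invg1 mul1g.
rewrite /wchar /= (prim_expr_mod zP) exprD mulrACA -big_split /=; congr (_ * _).
by apply: eq_bigr => k _; rewrite ffunE chiM.
Qed.

Definition wsingle k (g : GL) : wreath := (0, [ffun k' => if k' == k then g else 1%g], 1%g).

Lemma wsingle_borel k g : g \in B -> wsingle k g \in wborel.
Proof.
move=> Bg; apply/wborelP; split=> // k'; rewrite ffunE.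
by case: ifP => // _; apply: group1.
Qed.

Lemma wchar_single k g : wchar (wsingle k g) = chi k g.
Proof.
rewrite /wchar expr0 mul1r (bigD1 k) //= big1 => [|k' nk]; first by rewrite ffunE eqxx mulr1.
by rewrite ffunE (negbTE nk) chi1.
Qed.

(** Test on the elements of ['Z_N] for the action on [z], and on elements supported at one index for
    each factor; conjugation by [g] carries index [k] to [g.2 * k]. *)
Lemma agree_wchar (u : aut) (g : wreath) :
    (forall x y, x \in wborel -> y \in wborel -> (x * g = g * y)%g -> wchar x = u (wchar y)) ->
  u z = z ^+ act_unit g.2 /\
  (forall k x y, x \in B -> y \in B ->
    (x * g.1.2 (g.2 * k) = g.1.2 (g.2 * k) * y)%g -> chi (g.2 * k)%g x = u (chi k y)).
Proof.
case: g => [[v h] t] agr; split=> [|k x y Bx By /= xhy].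
  pose e c : wreath := (c, [ffun=> 1%g], 1%g).
  have De c : e c \in wborel by apply/wborelP; split=> // k; rewrite ffunE group1.
  have we c : wchar (e c) = z ^+ c.
    by rewrite /wchar big1 ?mulr1 // => k _; rewrite ffunE chi1.
  have := agr (e (act_unit t)) (e 1) (De _) (De _).
  rewrite !we => <- //=; rewrite !wreathM /wreath_mul /=; congr (_, _, _).
  - by rewrite act_unit1 mul1r mulr1 addrC.
  - by apply/ffunP => k; rewrite !ffunE invg1 !mul1g mulg1.
  by rewrite mul1g mulg1.
rewrite -(wchar_single (t * k)%g) -(wchar_single k).
apply: agr; rewrite ?wsingle_borel // !wreathM /wreath_mul /=; congr (_, _, _).
- by rewrite act_unit1 mul1r mulr0 addrC.
- apply/ffunP => k'; rewrite !ffunE invg1 mul1g (canF_eq (mulKg _)) invgK.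
  by case: eqP => [->|_]; rewrite ?mul1g ?mulg1.
by rewrite mul1g mulg1.
Qed.

(** Converse of [agree_wchar]: agreement is checked coordinate by coordinate. The shift in [g] makes
    [h k] the component at index [t * k]. *)
Lemma wchar_agree (u : aut) (t : aT) (h : aT -> GL) : u z = z ^+ act_unit t ->
    (forall k x y, x \in B -> y \in B ->
       (x * h k = h k * y)%g -> chi (t * k)%g x = u (chi k y)) ->
  forall x y, x \in wborel -> y \in wborel ->
    let g : wreath := (0, [ffun k => h (t^-1 * k)%g], t) in
    (x * g = g * y)%g -> wchar x = u (wchar y).
Proof.
move=> uz Dh [[c f] t1] [[c' f'] t1'] /wborelP[/= -> Bf] /wborelP[/= -> Bf'] xg.
have Ec : c + act_unit 1%g * 0 = 0 + act_unit t * c' by apply: (congr1 (fun w : wreath => w.1.1) xg).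
rewrite mulr0 addr0 add0r in Ec.
have Ef k : (f (t * k) * h k = h k * f' k)%g.
  have /ffunP/(_ (t * k)%g) := congr1 (fun w : wreath => w.1.2) xg.
  by rewrite !ffunE /= invg1 mul1g mulKg.
rewrite /wchar /= Ec rmorphM rmorphXn uz -exprM (prim_expr_mod zP); congr (_ * _).
rewrite rmorph_prod (reindex_inj (mulgI t)); apply: eq_bigr => k _ /=.
exact: Dh.
Qed.
End Wreath.

(** * Automorphisms fixing F *)

(** The multiplicative group is cyclic: a generator goes to a primitive complex root of unity of the
    same order, and 0 to 0. *)
Lemma finField_mulchar (Fq : finFieldType) : exists lam : Fq -> algC,
  [/\ lam 1 = 1, {morph lam : a b / a * b}, forall a, a != 0 -> lam a ^+ #|Fq|.-1 = 1 &
      exists2 a, a != 0 & #|Fq|.-1.-primitive_root (lam a)].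
Proof.
set n := #|Fq|.-1; have n0 : (0 < n)%N by rewrite /n -ltnS prednK ?finNzRing_gt1 // ltnW ?finNzRing_gt1.
have expn1 (a : Fq) : a != 0 -> a ^+ n = 1.
  move=> a0; apply: (mulfI a0); rewrite mulr1 -exprS prednK ?expf_card //.
  by rewrite ltnW ?finNzRing_gt1.
have /hasP[w _ wP] : has n.-primitive_root (enum [pred a : Fq | a != 0]).
  apply: has_prim_root => //; rewrite ?enum_uniq //.
    by apply/allP => a; rewrite mem_enum inE => /expn1/unity_rootP.
  by rewrite -cardE cardC1.
have [z zP] := C_prim_root_exists n0.
have log (a : Fq) : exists i : nat, a != 0 -> a = w ^+ i.
  case: (eqVneq a 0) => [_|/expn1/(prim_rootP wP)[i Di]]; first by exists 0%N.
  by exists i.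
have [i Di] := fin_all_exists log.
exists (fun a => if a == 0 then 0 else z ^+ i a).
have lamE (a : Fq) k : a = w ^+ k -> z ^+ i a = z ^+ k.
  move=> Da; apply/eqP; rewrite (eq_prim_root_expr zP) -(eq_prim_root_expr wP) -Da -Di //.
  by rewrite Da expf_eq0 (prim_root_eq0 wP) (gtn_eqF n0) andbF.
split=> [|a b|a a0|].
- by rewrite oner_eq0 (@lamE 1 0).
- rewrite mulf_eq0; case: eqVneq => [_|a0] /=; first by rewrite mul0r.
  case: eqVneq => [_|b0] /=; first by rewrite mulr0.
  by rewrite -exprD; apply: lamE; rewrite exprD -!Di.
- by rewrite (negbTE a0) exprAC (prim_expr_order zP) expr1n.
have w0 : w != 0 by rewrite (prim_root_eq0 wP) -lt0n.
by exists w => //; rewrite (negbTE w0) (@lamE w 1) ?expr1.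
Qed.

(** The quotient u z / v z is killed by [a], because z^a is a [b]-th root of unity, and likewise by
    [b]; hence it is 1. *)
Lemma eq_aut_coprime a b (u v : aut) : (0 < a)%N -> coprime a b ->
    (forall z, z ^+ a = 1 -> u z = v z) -> (forall z, z ^+ b = 1 -> u z = v z) ->
  forall z, z ^+ (a * b) = 1 -> u z = v z.
Proof.
move=> a0 co_ab uva uvb z zab; have [->|z0] := eqVneq z 0; first by rewrite !rmorph0.
have vz0 : v z != 0 by rewrite fmorph_eq0.
pose r := u z / v z.
have ra : r ^+ a = 1.
  by rewrite expr_div_n -!rmorphXn /= (uvb (z ^+ a)) ?divff ?fmorph_eq0 ?expf_neq0 // -exprM.
have rb : r ^+ b = 1.
  by rewrite expr_div_n -!rmorphXn /= (uva (z ^+ b)) ?divff ?fmorph_eq0 ?expf_neq0 // -exprM mulnC.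
have [d rP d_a] := prim_order_exists a0 ra.
have d_b : (d %| b)%N by rewrite (prim_order_dvd rP) rb.
have d1 : d = 1%N by apply/eqP; rewrite -dvdn1 -(eqP co_ab) dvdn_gcd d_a.
have /eqP := prim_expr_order rP; rewrite d1 expr1 -(inj_eq (mulIf vz0)) mul1r.
by rewrite /r divfK // => /eqP.
Qed.

(** * The image in the units of Z/N of the automorphisms fixing F *)

Section Fixer.
Variable F : cset.

Definition fixes (u : aut) := forall x, F x -> u x = x.

(** The exponent is a plain natural number, so that exponents modulo different powers of p can be
    compared. *)
Definition fix_exp (N v : nat) :=
  exists2 u : aut, fixes u & forall z, z ^+ N = 1 -> u z = z ^+ v.

Definition fixer N : {set {unit 'Z_N}} := [set v : {unit 'Z_N} | `[< fix_exp N (val v) >]].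

Lemma fix_exp_coprime N v : (0 < N)%N -> fix_exp N v -> coprime v N.
Proof.
move=> N0 [u _ Du]; have [z zP] := C_prim_root_exists N0.
have : N.-primitive_root (u z) by rewrite fmorph_primitive_root.
by rewrite (Du _ (prim_expr_order zP)) (prim_root_exp_coprime _ zP).
Qed.

Lemma Zp_expr N (z : algC) (v w : 'Z_N) : (1 < N)%N -> z ^+ N = 1 -> z ^+ (v * w)%R = z ^+ (v * w)%N.
Proof. by move=> N1 zN; rewrite /= [X in (_ %% X)%N]Zp_cast // expr_mod. Qed.

Lemma fixer_group_set N : (1 < N)%N -> group_set (fixer N).
Proof.
move=> N1; apply/group_setP; split=> [|v w].
  by rewrite inE; apply/asboolP; exists idfun => // z _; rewrite /= modn_small ?expr1 // Zp_cast.
rewrite !inE => /asboolP[u uF Du] /asboolP[u' uF' Du']; apply/asboolP.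
exists (u \o u') => [x Fx|z zN] /=; first by rewrite uF' ?uF.
by rewrite Du' // rmorphXn Du // -exprM -Zp_expr.
Qed.

Lemma aut_unit_exp (u : aut) N : (1 < N)%N ->
  exists v : {unit 'Z_N}, forall z, z ^+ N = 1 -> u z = z ^+ (val v : 'Z_N).
Proof.
move=> N1; have [z zP] := C_prim_root_exists (ltnW N1).
have [k co_kN Duz] := aut_prim_rootP u zP.
have Uk : (k%:R : 'Z_N) \is a GRing.unit by rewrite unitZpE // coprime_sym.
exists (FinRing.unit 'Z_N Uk) => _ /(prim_rootP zP)[i ->] /=.
by rewrite rmorphXn Duz val_Zp_nat // -!exprM mulnC -(prim_expr_mod zP) -[in RHS](prim_expr_mod zP) modnMmr.
Qed.

Lemma card_fixer N : (1 < N)%N -> #|fixer N| = (\sum_(0 <= v < N) `[< fix_exp N v >])%N.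
Proof.
move=> N1; have N0 := ltnW N1.
have -> : (\sum_(0 <= v < N) `[< fix_exp N v >] = \sum_(v : 'Z_N) `[< fix_exp N v >])%N.
  by rewrite -(big_mkord xpredT (fun v => nat_of_bool `[< fix_exp N v >])) Zp_cast.
rewrite -(card_imset _ val_inj) -sum1_card big_mkcond /=.
apply: eq_bigr => v _; congr (nat_of_bool _).
apply/imsetP/asboolP => [[w + ->]|fv]; first by rewrite inE => /asboolP.
have Uv : v \is a GRing.unit.
  by rewrite -[v]natr_Zp unitZpE // coprime_sym; apply: fix_exp_coprime.
by exists (FinRing.unit 'Z_N Uv) => //; rewrite inE; apply/asboolP.
Qed.

(** Since F lies in Q_(p^e0 m), whether [v] is realised modulo p^e depends only on its residue
    modulo p^e0, and each residue has p^(e - e0) lifts. *)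
Lemma card_fixer_lift p e0 e m : prime p -> (0 < e0)%N -> (e0 <= e)%N -> coprime p m ->
    subc F (Qcyc (p ^ e0 * m)) ->
  #|fixer (p ^ e)| = (p ^ (e - e0) * #|fixer (p ^ e0)|)%N.
Proof.
move=> p_pr e00 e0e co_pm FQ; have p1 := prime_gt1 p_pr; have p0 := ltnW p1.
have pe1 k : (0 < k)%N -> (1 < p ^ k)%N by move=> k0; rewrite -(exp1n k) ltn_exp2r.
have m0 : (0 < m)%N by case: m co_pm {FQ} => //; rewrite /coprime gcdn0 => /eqP Dp; rewrite Dp in p1.
have fixE v : fix_exp (p ^ e) v <-> fix_exp (p ^ e0) (v %% p ^ e0).
  split=> [[u uF Du]|fv].
    exists u => // z z1; rewrite expr_mod // Du // -(subnK e0e) expnD mulnC exprM z1 expr1n //.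
  have := fix_exp_coprime _ fv; rewrite expn_gt0 p0 => /(_ isT).
  rewrite coprime_modl coprime_pexpr // => co_vp; have [u uF Du] := fv.
  have [w wP] := C_prim_root_exists m0; have [j co_jm Duw] := aut_prim_rootP u wP.
  have co_em : coprime (p ^ e) m by rewrite coprimeXl.
  (* The automorphism of exponent [t] acts by [v] on p^e-th roots of unity and like [u] on m-th
     roots; it agrees with [u] on Q_(p^e0 m), hence fixes F. *)
  pose t := chinese (p ^ e) m v j.
  have tv : t = v %[mod p ^ e] by apply: chinese_modl.
  have tj : t = j %[mod m] by apply: chinese_modr.
  have co_t : coprime t (p ^ e * m).
    rewrite coprimeMr -coprime_modl tv coprime_modl coprimeXr //=.
    by rewrite -coprime_modl tj coprime_modl.
  have [u' Du'] := Qn_aut_exists co_t; exists u' => [x Fx|z z1].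
    have [o oP] : {o : algC | (p ^ e0 * m).-primitive_root o}.
      by apply: C_prim_root_exists; rewrite muln_gt0 expn_gt0 p0.
    rewrite -[RHS](uF x Fx); apply: (eq_aut_Qcyc oP _ (FQ x Fx)).
    apply: (@eq_aut_coprime (p ^ e0) m) (prim_expr_order oP); rewrite ?expn_gt0 ?p0 ?coprimeXl //.
      move=> z z1; rewrite Du // expr_mod // Du'; last first.
        by rewrite -(subnK e0e) expnD mulnAC mulnC exprM z1 expr1n.
      have z1e : z ^+ (p ^ e) = 1 by rewrite -(subnK e0e) expnD mulnC exprM z1 expr1n.
      by rewrite -(expr_mod t z1e) tv expr_mod.
    move=> _ /(prim_rootP wP)[i ->]; rewrite !rmorphXn Duw Du'; last first.
      by rewrite mulnC exprM (prim_expr_order wP) expr1n.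
    by rewrite -(prim_expr_mod wP t) tj (prim_expr_mod wP).
  rewrite Du' ?exprM ?z1 ?expr1n //.
  by rewrite -(expr_mod t z1) tv expr_mod.
rewrite !card_fixer ?pe1 // ?(leq_trans e00) //.
rewrite -[in X in index_iota 0 X](subnK e0e) expnD.
set f := (fun v => nat_of_bool `[< fix_exp (p ^ e0) v >]).
rewrite (eq_bigr (fun v => f (v %% p ^ e0)%N)) => [|v _]; last first.
  by congr (nat_of_bool _); apply: asbool_equiv_eq.
(* The range splits into [q] blocks of length p^e0, over each of which the periodic sum is the
   same. *)
move: (p ^ (e - e0))%N => q; elim: q => [|q IHq]; first by rewrite !mul0n big_geq.
have -> : (q.+1 * p ^ e0 = q * p ^ e0 + p ^ e0)%N by rewrite mulSn addnC.
rewrite (big_cat_nat (leq0n _) (leq_addr _ _)) /= IHq mulSn addnC; congr (_ + _)%N.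
rewrite -{1}[(q * p ^ e0)%N]add0n big_addn addKn !big_nat.
by apply: eq_bigr => v /andP[_ ltv]; rewrite addnC modnMDl modn_small.
Qed.
End Fixer.

(** * The irreducible character *)

(** Choose one automorphism for each exponent modulo [m] that occurs; the identity makes the list
    nonempty, hence the index type ['I_n.+1]. *)
Lemma fixer_reps F N m : (0 < m)%N -> exists n (w : 'I_n.+1 -> aut),
  [/\ forall i, fixes F (w i), forall i z, z ^+ N = 1 -> w i z = z,
      forall i j, (forall z, z ^+ m = 1 -> w i z = w j z) -> i = j &
      forall u, fixes F u -> (forall z, z ^+ N = 1 -> u z = z) ->
        exists i, forall z, z ^+ m = 1 -> u z = w i z].
Proof.
move=> m0; pose P (j : 'I_m) (u : aut) :=
  [/\ fixes F u, forall z, z ^+ N = 1 -> u z = z & forall z, z ^+ m = 1 -> u z = z ^+ j].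
pose W := [set j | `[< exists u, P j u >]].
have Pexp (u : aut) : fixes F u -> (forall z, z ^+ N = 1 -> u z = z) -> exists2 j, j \in W & P j u.
  move=> uF uN; have [z zP] := C_prim_root_exists m0.
  have [k _ Duz] := aut_prim_rootP u zP.
  have Pj : P (Ordinal (ltn_pmod k m0)) u.
    split=> // _ /(prim_rootP zP)[i ->] /=.
    by rewrite rmorphXn Duz -(prim_expr_mod zP k) exprAC.
  by exists (Ordinal (ltn_pmod k m0)); rewrite ?inE //; apply/asboolP; exists u.
have [j0 Wj0 _] := Pexp idfun (fun _ _ => erefl) (fun _ _ => erefl).
have W0 : (0 < #|W|)%N by apply/card_gt0P; exists j0.
case cW : #|W| W0 => [//|n] _; exists n.
have ex_w (i : 'I_n.+1) : exists u, P (enum_val (cast_ord (esym cW) i)) u.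
  by have := enum_valP (cast_ord (esym cW) i); rewrite inE => /asboolP.
have [w Pw] := fin_all_exists ex_w.
exists w; split=> [i|i|i j eqw|u uF uN]; try by case: (Pw i).
  have [z zP] := C_prim_root_exists m0.
  have [_ _ wi] := Pw i; have [_ _ wj] := Pw j.
  have /eqP := eqw z (prim_expr_order zP); rewrite wi ?wj ?(prim_expr_order zP) //.
  rewrite (eq_prim_root_expr zP) !modn_small // => /eqP/val_inj/enum_val_inj.
  exact: cast_ord_inj.
have [j Wj [_ _ uj]] := Pexp u uF uN.
exists (cast_ord cW (enum_rank_in Wj j)) => z z1.
have [_ _ ->//] := Pw (cast_ord cW (enum_rank_in Wj j)).
by rewrite cast_ordK enum_rankK_in // uj.
Qed.

(** * Construction of the character and computation of its field of values *)

Section Construction.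
Variables (F : cset) (Fq : finFieldType) (N : nat).
Local Notation m := #|Fq|.-1.
Hypotheses (Ff : is_subfield F) (Fu : forall (u : aut) x, F x -> F (u x)).
Hypotheses (N1 : (1 < N)%N) (co_Nm : coprime N m) (FQ : subc F (Qcyc (N * m))).

Let m0 : (0 < m)%N. Proof. by rewrite -ltnS prednK ?finNzRing_gt1 // ltnW ?finNzRing_gt1. Qed.

Let fixerG := Group (fixer_group_set F N1).
Local Notation aT := (subg_of fixerG).

Lemma fixer_lift (k : aT) : exists2 u, fixes F u & forall z, z ^+ N = 1 -> u z = z ^+ act_unit k.
Proof. by have := subgP k; rewrite inE => /asboolP. Qed.

Lemma exists_character : exists (gT : finGroupType) (G : {group gT}) (i : Iirr G),
    (forall x, field_of_values 'chi[G]_i x <-> F x) /\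
    (forall p k, prime p -> #|Fq| = (p ^ k)%N ->
       logn p (Num.truncn ('chi[G]_i 1%g)) = logn p #|fixer F N|).
Proof.
have [lam [lam1 lamM lam_m [g0 g00 lam_g0]]] := finField_mulchar Fq.
have [n [w [wF wN w_inj w_all]]] := fixer_reps F N m0.
have [uk ukF ukN] := fin_all_exists2 fixer_lift.
have [z zP] := C_prim_root_exists (ltnW N1).
have zP' : (Zp_trunc N).+2.-primitive_root z by rewrite Zp_cast.
pose l (k : aT) i a := uk k (w i (lam a)).
have lP k : mulfam (l k).
  by split=> [i|i a b]; rewrite /l ?lam1 ?rmorph1 // lamM !rmorphM.
pose chi k : {'GL_n.+1[Fq]} -> algC := torchar (l k).
pose gT : finGroupType := wreath {'GL_n.+1[Fq]} fixerG.
pose B := borel_group Fq n; pose D : {group gT} := wborel_group B fixerG.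
pose G : {group gT} := [set: gT]%G.
pose th : gT -> algC := wchar z chi.
have chi1 k : chi k 1%g = 1 by apply: torchar1.
have chiM k : {in B &, {morph chi k : x y / (x * y)%g >-> x * y}} by apply: torcharM.
have th1 : th 1%g = 1 by apply: wchar1.
have thM : {in D &, {morph th : x y / (x * y)%g >-> x * y}} by apply: wcharM.
have [theta theta_lin thetaE] : exists2 theta : 'CF(D), theta \is a linear_char &
    forall x, x \in D -> theta x = th x.
  by exists (mulchar th1 thM); [apply: mulchar_lin|apply: mulcharE].
have sDG : D \subset G by apply: subsetT.
have mN0 : (0 < N * m)%N by rewrite muln_gt0 (ltnW N1).
have QN : subc (Qcyc N) (Qcyc (N * m)) by apply: Qcyc_dvd => //; apply: dvdn_mulr.
have Qm : subc (Qcyc m) (Qcyc (N * m)) by apply: Qcyc_dvd => //; apply: dvdn_mull.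
have agreeP (u : aut) (g : gT) : agree theta (cfAut u theta) g ->
    u z = z ^+ act_unit g.2 /\
    forall k, exists s : 'S_n.+1,
      (forall i (a : {unit Fq}), u (l k i (val a)) = l (g.2 * k)%g (s i) (val a)) /\
      (s = 1%g -> g.1.2 (g.2 * k)%g \in B).
  move=> agr; have [|uz agrB] := agree_wchar (B := B) (z := z) chi1 (u := u) (g := g).
    by move=> x y Dx Dy xy; rewrite -[LHS]thetaE // (agr x y) // cfunE thetaE.
  by split=> // k; apply: agree_torchar => //; apply: agrB.
have g0U : g0 \is a GRing.unit by rewrite unitfE.
pose a0 : {unit Fq} := FinRing.unit Fq g0U.
have eq_m (u v : aut) : u (lam g0) = v (lam g0) -> forall y, y ^+ m = 1 -> u y = v y.
  by move=> uv y /(prim_rootP lam_g0)[i ->]; rewrite !rmorphXn uv.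
(* If [theta] agrees with itself along [g], then [z] forces [g.2 = 1]; the permutation at each [k]
   fixes every u_k w_i lam, so it is trivial as the [w i] are distinct on m-th roots, and [g] lies
   in [D]. *)
have theta_irr : 'Ind[G] theta \in irr G.
  apply: Ind_irr => // g _ agr.
  have [|gz gB] := agreeP idfun g; first by move=> x y Dx Dy xy; rewrite cfunE; exact: (agr x y Dx Dy xy).
  have g1 : g.2 = 1%g.
    apply: act_unit_inj; rewrite act_unit1; apply: val_inj.
    move/eqP: gz; rewrite -[X in X == _]expr1 (eq_prim_root_expr zP') !modn_small // => /eqP E.
    exact: esym E.
  apply/wborelP; split=> // k; have [s [Ds sB]] := gB k.
  rewrite g1 mul1g in Ds sB; apply: sB; apply/permP => i; rewrite perm1; symmetry.
  by apply/w_inj/eq_m/(fmorph_inj (uk k)); have := Ds i a0; rewrite /= /l.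
have thetau_lin (u : aut) : cfAut u theta \is a linear_char by rewrite cfAut_lin_char.
have /irrP[i Di] := theta_irr.
(* A fixed character is not orthogonal to its image, so some [g] gives agreement. Comparing one
   component, u u_1 w_0 and u_(g.2) w_(s 0) coincide on Q_(N m), which contains F; the chosen
   automorphisms fix F, hence so does [u]. *)
have stab1 (u : aut) : cfAut u 'chi_i = 'chi_i -> fixes F u.
  move=> fixu; have [g agr] : exists g, agree theta (cfAut u theta) g.
    apply: contrapT => nagr.
    have /eqP := cfdot_Ind_eq0 sDG theta_lin (thetau_lin u) (fun g _ agr => nagr (ex_intro _ g agr)).
    by rewrite -cfAutInd Di fixu cfnorm_irr oner_eq0.
  have [uz /(_ 1%g)[s [/(_ ord0 a0) Ds _]]] := agreeP u g agr.
  have [o oP] := C_prim_root_exists mN0.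
  have eq_u : u (uk 1%g (w ord0 o)) = uk (g.2 * 1)%g (w (s ord0) o).
    apply: (@eq_aut_coprime N m (u \o (uk 1%g \o w ord0)) (uk (g.2 * 1)%g \o w (s ord0))).
    - exact: ltnW.
    - by [].
    - move=> y yN /=; rewrite !wN // !ukN // mulg1 act_unit1 expr1.
      by have [j ->] := prim_rootP zP yN; rewrite rmorphXn uz exprAC.
    - exact: (eq_m (u \o (uk 1%g \o w ord0)) (uk (g.2 * 1)%g \o w (s ord0)) Ds).
    exact: prim_expr_order.
  move=> x Fx; have := @eq_aut_Qcyc _ _ (u \o (uk 1%g \o w ord0)) (uk (g.2 * 1)%g \o w (s ord0)) oP eq_u x (FQ Fx).
  by rewrite /= !wF // !ukF.
have stab2 (u : aut) : fixes F u -> cfAut u 'chi_i = 'chi_i.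
  move=> uF; have [v uv] := aut_unit_exp u N1.
  have Av : v \in fixerG by rewrite inE; apply/asboolP; exists u.
  pose t : aT := Subg Av.
  (* The automorphism u_(t k)^-1 u u_k w_i fixes F and the N-th roots of unity, so on m-th roots it
     is some [w j]; the map from i to j is the permutation sought. *)
  have ex_s k : exists s : 'S_n.+1, forall i (a : {unit Fq}), u (l k i (val a)) = l (t * k)%g (s i) (val a).
    pose v' i : aut := algC_invaut (uk (t * k)%g) \o (u \o (uk k \o w i)).
    have ex_j i' : exists j, forall y, y ^+ m = 1 -> v' i' y = w j y.
      apply: w_all => [x Fx|y yN] /=; apply: (fmorph_inj (uk (t * k)%g)); rewrite algC_invautK.
        by rewrite wF // !ukF // uF.
      by rewrite wN // !ukN // rmorphXn uv // act_unitM -exprM -Zp_expr.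
    have [s Ds] := fin_all_exists ex_j.
    have s_inj : injective s.
      move=> i1 i2 Dsi; apply: w_inj => y y1.
      have : v' i1 y = v' i2 y by rewrite !Ds // Dsi.
      by move/(congr1 (uk (t * k)%g)); rewrite /= !algC_invautK => /fmorph_inj/fmorph_inj.
    exists (perm s_inj) => i1 a; rewrite permE /l -Ds /= ?algC_invautK // lam_m //.
    by rewrite -unitfE (valP a).
  have [s Ds] := fin_all_exists ex_s.
  have uz : u z = z ^+ act_unit t by rewrite uv // prim_expr_order.
  pose g : gT := (0, [ffun k => permGL Fq (s (t^-1 * k)%g)^-1], t).
  have agr : agree theta (cfAut u theta) g.
    move=> x y Dx Dy xy; rewrite cfunE !thetaE //.
    apply: (wchar_agree (B := B) zP' (h := fun k => permGL Fq (s k)^-1) uz _ Dx Dy xy).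
    move=> k; exact: (torchar_agree (Ds k)).
  have := cfdot_Ind_neq0 sDG theta_lin (thetau_lin u) (in_setT g) agr.
  rewrite -cfAutInd Di -aut_IirrE cfdot_irr.
  by case: (i =P aut_Iirr u i) => [<-|_]; rewrite ?eqxx.
have Qlam a : Qcyc (N * m) (lam a).
  have [->|a_n0] := eqVneq a 0; last by apply: Qm; apply: cyc_ext_unity => //; apply: lam_m.
  (* Multiplicativity makes [lam 0] idempotent, hence 0 or 1. *)
  have /eqP := lamM 0 0; rewrite mulr0 -{1}[lam 0]mulr1 -subr_eq0 -mulrBr mulf_eq0 subr_eq0.
  case/orP=> [/eqP->|/eqP<-]; [exact: (subfield0 (Qcyc_subfield _))|exact: (subfield1 (Qcyc_subfield _))].
have QD y : Qcyc (N * m) (theta y).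
  have [Dy|/cfun0->] := boolP (y \in D); last exact: (subfield0 (Qcyc_subfield _)).
  rewrite thetaE // /th /wchar; apply: (subfieldM (Qcyc_subfield _)).
    apply: (subfieldX (Qcyc_subfield _)); apply: QN; apply: cyc_ext_unity; first exact: ltnW.
    exact: prim_expr_order.
  apply: (subfield_prod (Qcyc_subfield _)) => k _; apply: (subfield_prod (Qcyc_subfield _)) => i1 _.
  by do 2!apply: aut_Qcyc.
have Qchi y : Qcyc (N * m) ('chi_i y).
  rewrite -Di cfIndE //; apply: (subfieldM (Qcyc_subfield _)).
    by apply: (subfieldV (Qcyc_subfield _)); apply: (subfield_nat (Qcyc_subfield _)).
  by apply: (subfield_sum (Qcyc_subfield _)).
have mem_val g : field_of_values 'chi_i ('chi_i g) by move=> K _; apply; exists g.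
have vals_Q : subc (field_of_values 'chi_i) (Qcyc (N * m)).
  by apply: gen_min => [|y [g ->]] //; apply: Qcyc_subfield.
exists gT, G, i; split=> [x|p k p_pr cF].
  (* Galois descent both ways: by [stab2] an automorphism fixing F fixes all values, and by [stab1]
     one fixing all values fixes F. *)
  split=> [|Fx]; first move: x.
    apply: gen_min => // _ [g ->]; apply: (@mem_fixed (N * m)) => // u uF.
    by rewrite -[in RHS](stab2 u) // cfunE.
  apply: (@mem_fixed (N * m)) => //; first exact: gen_subfield.
  - move=> u y; move: y; apply: gen_min => [|_ [g ->]]; first exact: (preim_subfield u (gen_subfield _)).
    by have [h ->] := char_aut u g (irr_char i).
  - exact: FQ.
  move=> u fixv; apply: stab1 Fx; apply/cfunP => g; rewrite cfunE.
  exact: fixv.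
rewrite -Di cfInd1 // thetaE // th1 mulr1 natrK.
by apply: logn_index_wborel; rewrite -?cardsT; apply: logn_card_borel cF.
Qed.
End Construction.

(** The chosen lifts of the elements of [fixer F N] represent each automorphism of F(z) over F
    exactly once, for [z] a primitive N-th root of unity. *)
Lemma is_degree_card_fixer F n N d : (0 < n)%N -> is_subfield F -> subc F (Qcyc n) ->
    (forall (u : aut) y, F y -> F (u y)) -> (1 < N)%N ->
  is_degree F (cyc_ext F N) d -> d = #|fixer F N|.
Proof.
move=> n0 Ff FQ Fu N1 degd; have [z zP] := C_prim_root_exists (ltnW N1).
have [us usF usN] := fin_all_exists2 (@fixer_lift F N N1).
have zN := prim_expr_order zP.
have zP' : (Zp_trunc N).+2.-primitive_root z by rewrite Zp_cast.
have <- : #|{: subg_of (Group (fixer_group_set F N1))}| = #|fixer F N| by rewrite card_sub.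
apply: (is_degree_fixers (us := us) n0 Ff FQ Fu zP _ _ _ degd) => // [i j|u uF].
  rewrite !usN // => /eqP; rewrite (eq_prim_root_expr zP') !modn_small //.
  by move=> /eqP/val_inj/act_unit_inj.
have [v uv] := aut_unit_exp u N1.
have Av : v \in Group (fixer_group_set F N1) by rewrite inE; apply/asboolP; exists u.
by exists (Subg Av); rewrite usN // uv.
Qed.

(** The group sits inside the units of Z/p, of order p - 1 < p. *)
Lemma logn_card_fixer_prime F p : prime p -> logn p #|fixer F p| = 0%N.
Proof.
move=> p_pr; apply: ltn_log0; apply: leq_ltn_trans (subset_leq_card (subsetT _)) _.
rewrite -[[set: _]]/(units_Zp p) card_units_Zp ?prime_gt0 // totient_prime //.
by rewrite prednK ?prime_gt0.
Qed.

Theorem theoremA (p : nat) (F : cset) :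
  prime p -> abelian_ext F ->
  forall c : nat, is_conductor F c ->
  let a := logn p c in
  forall d : nat, is_degree F (cyc_ext F (p ^ a)) d ->
  forall b : nat, (logn p d <= b)%N ->
  exists (gT : finGroupType) (G : {group gT}) (i : Iirr G),
    (forall x, field_of_values 'chi[G]_i x <-> F x) /\
    logn p (Num.truncn ('chi[G]_i 1%g)) = b.
Proof.
move=> p_pr [Ff _ Fu _] c [c0 FQ _] a d degd b le_db.
have p1 := prime_gt1 p_pr; have p0 := ltnW p1.
pose m0 := (c`_p^')%N; have m00 : (0 < m0)%N by apply: part_gt0.
have co_pm0 : coprime p m0 by rewrite (pnat_coprime (pnat_id p_pr)) ?part_pnat.
have Dc : c = (p ^ a * m0)%N by rewrite -p_part partnC.
(* By [card_fixer_lift] the left side of the last equation is the p-adic valuation of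
   [#|fixer F (p ^ e)|]. If a = 0, start from e0 = 1, where the valuation is 0; otherwise from e0 =
   a, where the order is [d]. *)
have [e0 [e [e00 le_ae0 le_e0e De]]] : exists e0 e, [/\ (0 < e0)%N, (a <= e0)%N, (e0 <= e)%N &
    (e - e0 + logn p #|fixer F (p ^ e0)|)%N = b].
  case: (posnP a) => [a0|a_gt0].
    by exists 1%N, b.+1; rewrite a0 expn1 logn_card_fixer_prime // subn1 addn0.
  exists a, (a + (b - logn p d))%N; rewrite leq_addr; split=> //.
  rewrite -(is_degree_card_fixer c0 Ff FQ Fu _ degd) ?addKn ?subnK //.
  by rewrite -(exp1n a) ltn_exp2r.
have e_gt0 := leq_trans e00 le_e0e.
have pe1 k : (0 < k)%N -> (1 < p ^ k)%N by move=> k0; rewrite -(exp1n k) ltn_exp2r.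
have FQ0 : subc F (Qcyc (p ^ e0 * m0)).
  move=> x /FQ; apply: Qcyc_dvd; first by rewrite muln_gt0 expn_gt0 p0.
  by rewrite Dc dvdn_mul ?dvdn_exp2l.
have tot0 : (0 < totient m0)%N by rewrite totient_gt0.
(* For q = p^(totient m0), Euler's theorem gives that [m0] divides q - 1. *)
have [Fq _ cF] := pPrimePowerField p_pr tot0.
have m_gt0 : (0 < #|Fq|.-1)%N by rewrite cF -ltnS prednK ?expn_gt0 ?p0 // pe1.
have m0_dvd : (m0 %| #|Fq|.-1)%N.
  rewrite cF -subn1 -eqn_mod_dvd ?expn_gt0 ?p0 //.
  by apply/eqP/Euler_exp_totient.
have co_pm : coprime (p ^ e) #|Fq|.-1.
  rewrite coprimeXl // prime_coprime // cF; apply/negP => dvp.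
  have : (p %| (p ^ totient m0).-1.+1)%N by rewrite prednK ?expn_gt0 ?p0 // dvdn_exp.
  by rewrite -addn1 dvdn_addr // dvdn1 => /eqP p_1; rewrite p_1 in p1.
have FQe : subc F (Qcyc (p ^ e * #|Fq|.-1)).
  move=> x /FQ0; apply: Qcyc_dvd; first by rewrite muln_gt0 expn_gt0 p0.
  by rewrite dvdn_mul ?dvdn_exp2l.
have [gT [G [i [chiF chi1]]]] := exists_character Ff Fu (pe1 e e_gt0) co_pm FQe.
exists gT, G, i; split=> //; rewrite (chi1 p _ p_pr cF).
rewrite (card_fixer_lift p_pr e00 le_e0e co_pm0 FQ0) lognM ?expn_gt0 ?p0 //.
  by rewrite pfactorK.
exact: (cardG_gt0 (Group (fixer_group_set F (pe1 e0 e00)))).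
Qed.
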